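(* For every $A>0$ there exists a constant $C>0$, depending only on $A$, such that the following holds. Let $\alpha\in(0,1)$, let $K\in\mathbb{R}^{N\times N}$ be a symmetric matrix with $0\preceq K\preceq I_N$ such that for all $1\le i<j\le N$ either $K_{i,j}=0$ or $|K_{i,j}|\ge\alpha$, let $\ell$ be the cycle sparsity of the graph $G_K$ induced by $K$, and let $\varepsilon>0$. Let $Y_1,\dots,Y_n$ be i.i.d. samples from $\mathsf{DPP}(K)$ and let $\hat K$ be the method of moments estimator built from $Y_1,\dots,Y_n$ and $\alpha$ (defined in the context). If $$ n\ \ge\ C\Big(\frac{1}{\alpha^2\varepsilon^{2}}+\ell\Big(\frac{4}{\alpha}\Big)^{2\ell}\Big)\log N, $$ then $\rho(\hat K,K)\le\varepsilon$ with probability at least $1-N^{-A}$.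
   Context: $[N]=\{1,\dots,N\}$. For $S\subseteq[N]$, $K_S$ is the principal submatrix of $K$ indexed by $S$. For symmetric $K$ with $0\preceq K\preceq I_N$, $\mathsf{DPP}(K)$ is the distribution of the random subset $Y\subseteq[N]$ with $\mathbb{P}[J\subseteq Y]=\det(K_J)$ for all $J\subseteq[N]$. The graph induced by $K$ is $G_K=([N],E)$ with $\{i,j\}\in E$ ($i\ne j$) iff $K_{i,j}\neq0$. $\mathcal{D}_N$ is the set of $N\times N$ diagonal matrices with diagonal entries in $\{-1,1\}$, and $$\rho(K,K')=\inf_{D\in\mathcal{D}_N}|DKD-K'|_\infty,\qquad |M|_\infty=\max_{i,j\in[N]}|M_{i,j}|.$$ Cycles: for a graph $G=([N],E)$, $|E|=m$, a cycle is a connected subgraph in which every vertex has even degree, with incidence vector in $GF(2)^m$; the cycle space is the span of these vectors in $GF(2)^m$, of dimension $\nu_G=m-N+\kappa(G)$, with $\kappa(G)$ the number of connected components. A simple cycle is a cycle whose vertices of nonzero degree have degree two and form a connected set; a cycle basis is a basis of the cycle space consisting of simple cycles. The cycle sparsity of $G$ is the minimal $\ell$ for which $G$ has a cycle basis of induced cycles of length at most $\ell$ (with $\ell=2$ if the cycle space is trivial); a cycle basis of induced cycles attaining this minimum is called a shortest maximal cycle basis. Estimator $\hat K$. For $S\subseteq[N]$ let $\hat\Delta_S=\frac1n\sum_{p=1}^n\mathbf 1_{S\subseteq Y_p}$. Set $\hat K_{i,i}=\hat\Delta_{\{i\}}$ and, for $i\ne j$, $\hat B_{i,j}=\hat K_{i,i}\hat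 K_{j,j}-\hat\Delta_{\{i,j\}}$. Let $\hat G=([N],\hat E)$ with $\{i,j\}\in\hat E$ iff $\hat B_{i,j}\ge\frac12\alpha^2$, and $\hat m=|\hat E|$. Let $\hat C_1,\dots,\hat C_{\nu_{\hat G}}$ be a shortest maximal cycle basis of $\hat G$ and $\hat S_i$ the vertex set of $\hat C_i$. For each $i$ let $$\hat H_i=\hat\Delta_{\hat S_i}-\sum_{M\in\mathcal{M}(\hat S_i)}(-1)^{|M|}\prod_{\{j,k\}\in M}\hat B_{j,k}\prod_{j\in\hat S_i\setminus V(M)}\hat K_{j,j},$$ where $\mathcal{M}(S)$ is the set of all matchings (including the empty one) of the subgraph of $\hat G$ induced by $S$ and $V(M)$ is the set of vertices covered by $M$. Let $A'\in GF(2)^{\nu_{\hat G}\times\hat m}$ have $i$-th row the incidence vector of $\hat C_i$, let $b\in GF(2)^{\nu_{\hat G}}$ have $b_i=\frac12[\mathrm{sgn}(\hat H_i)+1]$ (with any fixed convention $\mathrm{sgn}(0)\in\{-1,1\}$), and let $x\in GF(2)^{\hat m}$ be a solution of $A'x=b$ if one exists and the all-ones vector otherwise. Finally, for $i\neq j$, $\hat K_{i,j}=0$ if $\{i,j\}\notin\hat E$, and $\hat K_{i,j}=\hat K_{j,i}=(2x_{\{i,j\}}-1)\hat B_{i,j}^{1/2}$ if $\{i,j\}\in\hat E$ (with $x_{\{i,j\}}$ read as the integer $0$ or $1$). *)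

(* Defs.v *)
From HB Require Import structures.
From mathcomp Require Import all_boot all_order all_algebra.

Set Implicit Arguments.
Unset Strict Implicit.
Unset Printing Implicit Defensive.

Import Order.TTheory GRing.Theory Num.Theory.
Local Open Scope ring_scope.

(* A graph on the vertex set 'I_N is given by its edge set G : {set {set 'I_N}},
   whose elements are pairs [set i; j] with i != j. A subgraph without isolated
   vertices is a subset C of G; its vertex set is then cover C. *)
Section Graphs.
Variable N : nat.
Implicit Types (G C M : {set {set 'I_N}}) (S : {set 'I_N}).

Definition degree C (v : 'I_N) : nat := #|[set e in C | v \in e]|.

Definition connected_edges C : bool :=
  [forall v in cover C, forall w in cover C,
     connect [rel a b | [set a; b] \in C] v w].

Definition is_cycle G C : bool :=
  [&& C \subset G, [forall v, ~~ odd (degree C v)] & connected_edges C].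

Definition simple_cycle G C : bool :=
  is_cycle G C && [forall v, (degree C v != 0%N) ==> (degree C v == 2%N)].

Definition induced_edges G S : {set {set 'I_N}} := [set e in G | e \subset S].

Definition induced_cycle G C : bool :=
  simple_cycle G C && (C == induced_edges G (cover C)).

(* Coordinates of GF(2)^m are indexed by the edges of G, listed by enum_val. *)
Definition incidence G C : 'rV['F_2]_#|G| :=
  \row_(r < #|G|) (enum_val r \in C)%:R.

Definition cycle_space G : {vspace 'rV['F_2]_#|G|} :=
  <<[seq incidence G C | C in is_cycle G]>>%VS.

Definition cycle_basis G (Cs : seq {set {set 'I_N}}) : bool :=
  basis_of (cycle_space G) [seq incidence G C | C <- Cs]
  && all (simple_cycle G) Cs.

Definition induced_cycle_basis G (l : nat) (Cs : seq {set {set 'I_N}}) : bool :=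
  [&& cycle_basis G Cs, all (induced_cycle G) Cs
    & all (fun C => #|C| <= l)%N Cs].

Definition is_cycle_sparsity G (l : nat) : Prop :=
  if cycle_space G == 0%VS then l = 2%N else
    (exists Cs, induced_cycle_basis G l Cs) /\
    (forall l' Cs, induced_cycle_basis G l' Cs -> (l <= l')%N).

Definition shortest_maximal_cycle_basis G (Cs : seq {set {set 'I_N}}) : Prop :=
  exists2 l, is_cycle_sparsity G l & induced_cycle_basis G l Cs.

Definition matchings G S : {set {set {set 'I_N}}} :=
  [set M : {set {set 'I_N}} | (M \subset induced_edges G S) && trivIset M].

(* The coordinate x_e of x : GF(2)^m at the edge e: the sum has exactly one
   term when e is an edge of G. *)
Definition edge_coord G (x : 'cV['F_2]_#|G|) (e : {set 'I_N}) : 'F_2 :=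
  \sum_(r < #|G| | enum_val r == e) x r 0.

End Graphs.

(* Any solution of A x = b if there is one, the all-ones vector otherwise. *)
Definition solution_or_ones (k m : nat) (A : 'M['F_2]_(k, m))
    (b : 'cV['F_2]_k) (x : 'cV['F_2]_m) : bool :=
  if [exists y : 'cV['F_2]_m, A *m y == b] then A *m x == b
  else x == const_mx 1.

Section Matrices.
Variables (R : realDomainType) (N : nat).
Implicit Types K M D : 'M[R]_N.

Definition psd M : Prop := forall v : 'cV[R]_N, 0 <= (v^T *m M *m v) 0 0.

Definition principal K (S : {set 'I_N}) : 'M[R]_#|S| :=
  \matrix_(a < #|S|, b < #|S|) K (enum_val a) (enum_val b).

Definition graph_of K : {set {set 'I_N}} :=
  [set [set i; j] | i in 'I_N, j in 'I_N & (i != j) && (K i j != 0)].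

Definition sign_diag D : bool :=
  is_diag_mx D && [forall i, (D i i == -1) || (D i i == 1)].

End Matrices.

Section Estimator.
Variables (R : rcfType) (N n : nat) (alpha : R).
(* s0 is the convention for sgn(0). *)
Variable s0 : int.
Variable y : {ffun 'I_n -> {set 'I_N}}.

Definition Delta_hat (S : {set 'I_N}) : R :=
  n%:R^-1 * \sum_(p < n) (S \subset y p)%:R.

Definition Kdiag_hat (i : 'I_N) : R := Delta_hat [set i].

Definition B_hat (i j : 'I_N) : R :=
  Kdiag_hat i * Kdiag_hat j - Delta_hat [set i; j].

Definition G_hat : {set {set 'I_N}} :=
  [set [set i; j] | i in 'I_N, j in 'I_N &
     (i != j) && (2^-1 * alpha ^+ 2 <= B_hat i j)].

Definition H_hat (S : {set 'I_N}) : R :=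
  Delta_hat S -
  \sum_(M in matchings G_hat S)
    (-1) ^+ #|M|
    * (\prod_(j < N) \prod_(k < N | (j < k)%N && ([set j; k] \in M)) B_hat j k)
    * \prod_(j in S :\: cover M) Kdiag_hat j.

Definition sgn_conv (h : R) : int := if h == 0 then s0 else sgz h.

Definition cycle_matrix (Cs : seq {set {set 'I_N}}) :
    'M['F_2]_(size Cs, #|G_hat|) :=
  \matrix_(i < size Cs) incidence G_hat (nth set0 Cs i).

Definition cycle_signs (Cs : seq {set {set 'I_N}}) : 'cV['F_2]_(size Cs) :=
  \col_(i < size Cs)
    ((sgn_conv (H_hat (cover (nth set0 Cs i))) + 1) %/ 2)%Z%:~R.

Definition K_hat (x : 'cV['F_2]_#|G_hat|) : 'M[R]_N :=
  \matrix_(i < N, j < N)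
    if i == j then Kdiag_hat i
    else if [set i; j] \in G_hat then
      (2 * (nat_of_ord (edge_coord x [set i; j]))%:R - 1) * Num.sqrt (B_hat i j)
    else 0.

(* The construction leaves free the choice of the basis Cs and of the solution
   x; Khat is an admissible output on the data y if it comes from some valid
   choice. *)
Definition moment_estimate (Khat : 'M[R]_N) : Prop :=
  exists (Cs : seq {set {set 'I_N}}) (x : 'cV['F_2]_#|G_hat|),
    [/\ shortest_maximal_cycle_basis G_hat Cs,
        solution_or_ones (cycle_matrix Cs) (cycle_signs Cs) x
      & Khat = K_hat x].

End Estimator.

From mathcomp Require Import all_classical all_reals all_analysis.
Import numFieldNormedType.Exports.
Local Open Scope classical_set_scope.

(* mx_norm M is the largest absolute value of an entry of M. *)
Definition rho (R : realType) (N : nat) (K K' : 'M[R]_N) : R :=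
  inf [set mx_norm (D *m K *m D - K') | D in [set D | sign_diag D]].

Section Sampling.
Context (R : realType) (d : measure_display) (T : measurableType d).
Variables (P : probability T R) (N : nat).

Definition random_subset (Y : T -> {set 'I_N}) : Prop :=
  forall S : {set 'I_N}, measurable [set t | Y t = S].

Definition has_law_DPP (K : 'M[R]_N) (Y : T -> {set 'I_N}) : Prop :=
  forall J : {set 'I_N},
    P [set t | J \subset Y t] = (\det (principal K J))%:E.

(* Taking B p = setT for some p gives the product rule for subfamilies. *)
Definition mutually_independent (n : nat) (Y : 'I_n -> T -> {set 'I_N}) : Prop :=
  forall B : 'I_n -> {set {set 'I_N}},
    P [set t | forall p, Y p t \in B p]
    = (\prod_(p < n) P [set t | Y p t \in B p])%E.

Definition iid_DPP (n : nat) (K : 'M[R]_N) (Y : 'I_n -> T -> {set 'I_N}) : Prop :=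
  [/\ forall p, random_subset (Y p),
      mutually_independent Y
    & forall p, has_law_DPP K (Y p)].

End Sampling.

(* Main.v *)
Require Import Defs.
From mathcomp Require Import all_boot all_order all_fingroup all_algebra.
From mathcomp Require Import ring lra.

Set Implicit Arguments.
Unset Strict Implicit.
Unset Printing Implicit Defensive.

Import Order.TTheory GRing.Theory Num.Theory.
Local Open Scope ring_scope.

(** The law of a determinantal point process determines K only up to the signs
    of a diagonal conjugation, and both halves of the estimator rest on explicit
    formulas for its moments D_S = det K_S.

    Moduli. D_{i} = K_ii and K_ii K_jj - D_{ij} = K_ij^2, so if the empirical
    moments of the sets of at most two elements are within delta of the true
    ones, then B_hat i j is within 3 delta of K_ij^2. The gap alpha in the
    entries then makes the estimated graph exact ([G_hat_eq]), and dividing by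
    s + |K_ij| >= alpha in s^2 - K_ij^2 = (s - |K_ij|)(s + |K_ij|), where
    s^2 = B_hat i j, gives entries with an error at most eps once
    3 delta <= alpha eps.

    Signs. Let S be the vertex set of an induced cycle C. A permutation of S
    that contributes to det K_S moves every vertex along an edge of C or fixes
    it; it is then either an involution, that is, a matching of C, or one of the
    two rotations of the whole cycle. Hence ([det_induced_cycle])
      D_S = (sum over matchings) + 2 (-1)^(|C|+1) prod_(e in C) K_e,
    and the last term has modulus at least 2 alpha^|C|. There are at most
    2^|C| matchings, each a product of at most |C| factors in [-1, 1], so
    moments accurate up to (alpha / 4)^l / 4 leave an error smaller than
    2 alpha^|C| in H_hat, whose sign is therefore the right one ([H_hat_sign]).
    The true signs of the K_e thus solve the linear system A' x = b over GF(2).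
    Any other solution differs from it by a vector orthogonal to a basis of the
    cycle space, hence to all cycles; such a vector is a coboundary
    u_i + u_j ([orthogonal_cycles_coboundary]), and (-1)^u is the diagonal of
    the required conjugation ([estimate_recovers]).

    Probability. The sample is a random element of a finite set whose law is a
    product, so an exponential moment bound ([product_mass_tail]) yields
    P(|Delta_hat S - D_S| > e) <= 2 exp(- n e^2 / 4). The cycle basis that the
    estimator selects depends on the data, so the bound is needed for all of the
    at most N^l vertex sets of size at most l at once; this is the origin of the
    factor l in the sample size. The accuracy eps only concerns the at most N^2
    sets of size at most two, and is paid for without that factor. *)

(** * Permutations along a cycle *)

Lemma perm_in_porbit (T : finType) (s : {perm T}) (x : T) : s x \in porbit s x.
Proof. by rewrite -{1}[s]expg1 mem_porbit. Qed.

Section CyclicOrder.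
Variables (T : finType) (E : rel T).
Hypothesis Esym : symmetric E.
Hypothesis Eirr : irreflexive E.
Hypothesis Ereg : forall x, #|[set y | E x y]| = 2%N.
Hypothesis Econ : forall x y, connect E x y.

Lemma other_neighbor x y : E x y ->
  exists z, [/\ E x z, z != y & forall w, E x w -> w = y \/ w = z].
Proof.
move=> Exy; have /eqP/cards2P[a [b [neq_ab Nx]]] := Ereg x.
have NxP w : E x w = (w == a) || (w == b).
  by have /setP/(_ w) := Nx; rewrite !inE.
move: Exy; rewrite NxP => /orP[]/eqP->.
  exists b; rewrite NxP eqxx orbT eq_sym neq_ab; split=> // w.
  by rewrite NxP => /orP[]/eqP->; [left | right].
exists a; rewrite NxP eqxx neq_ab; split=> // w.
by rewrite NxP => /orP[]/eqP->; [right | left].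
Qed.

Definition other y x := odflt x [pick z | E y z && (z != x)].

Lemma otherP x y : E y x ->
  [/\ E y (other y x), other y x != x
    & forall w, E y w -> w = x \/ w = other y x].
Proof.
move=> Eyx; have [z [Eyz zx zP]] := other_neighbor Eyx.
rewrite /other; case: pickP => [w /andP[Eyw wx]|/(_ z)]; last by rewrite Eyz zx.
by case: (zP w Eyw) wx => [->|->]; rewrite ?eqxx.
Qed.

Lemma otherK x y : E y x -> other y (other y x) = x.
Proof.
move=> Eyx; have [Eyo ox _] := otherP Eyx; have [_ _ oP] := otherP Eyo.
by case: (oP x Eyx) => // xo; rewrite -xo eqxx in ox.
Qed.

(** Existence of a cyclic order goes through darts, that is, oriented edges. In a
    2-regular graph a walk that never turns back is determined by its first
    dart, which gives a permutation of the darts; the vertices met along one of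
    its orbits, in the order of the walk, are the cycle. *)
Definition reverse (d : T * T) := (d.2, d.1).

Definition dart_step (d : T * T) : T * T :=
  if E d.1 d.2 then (d.2, other d.2 d.1) else d.

Lemma dart_stepE d : E (dart_step d).1 (dart_step d).2 = E d.1 d.2.
Proof.
rewrite /dart_step; case: ifP => // Ed /=.
by rewrite Esym in Ed; have [] := otherP Ed.
Qed.

(** Walking one step, turning around and walking again ends on the first dart
    reversed: reversal conjugates the walk to its inverse. *)
Lemma dart_step_reverse d : dart_step (reverse (dart_step d)) = reverse d.
Proof.
have := dart_stepE d; rewrite {2 3}/dart_step.
rewrite /dart_step /reverse; case: d => x y /=.
case: ifP => Exy /= => [Eyo|_]; last by rewrite Esym Exy.
by rewrite Esym Eyo otherK // Esym.
Qed.

Lemma dart_step_inj : injective dart_step.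
Proof.
apply: (@can_inj _ _ _ (reverse \o dart_step \o reverse)) => d /=.
by rewrite dart_step_reverse; case: d.
Qed.

Let next : {perm T * T} := perm dart_step_inj.

Lemma next_darts d m : E ((next ^+ m)%g d).1 ((next ^+ m)%g d).2 = E d.1 d.2.
Proof.
by elim: m => [|m IHm]; rewrite ?expg0 ?perm1 // expgSr permM permE dart_stepE.
Qed.

(** The walk started at d never meets the reverse of d. If it did after m + 2
    steps, the walk started one step later would meet its own reverse after m
    steps, since reversal inverts the walk. Meeting it at once would make the two
    ends of an edge equal, and after one step would be a turn back. *)
Lemma reverse_notin_orbit m d : E d.1 d.2 -> (next ^+ m)%g d != reverse d.
Proof.
elim/ltn_ind: m d => -[|[|m]] IHm [x y] /= Exy.
- by rewrite expg0 perm1 xpair_eqE; apply: contraTN Exy => /andP[/eqP-> _]; rewrite Eirr.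
- rewrite expg1 permE /dart_step /= Exy xpair_eqE eqxx /=.
  by rewrite Esym in Exy; have [] := otherP Exy.
have := IHm m (leqnSn _) (next (x, y)).
rewrite permE dart_stepE Exy => /(_ isT); apply: contraNneq => eq_r.
apply/eqP/(@perm_inj _ next); rewrite [RHS]permE dart_step_reverse.
by rewrite -eq_r -(permE dart_step_inj) -!permM -expgSr -expgS.
Qed.

(** In the orbit of one dart, each vertex starts exactly one dart: at least one
    because the set of such vertices is closed under adjacency and the graph is
    connected, at most one because of two darts leaving x the second would be
    the reverse of the dart preceding the first. So the orbit is the graph of a
    function on vertices, which is the desired permutation. *)
Lemma cyclic_order : (0 < #|T|)%N ->
  exists c : {perm T},
    [/\ forall x y, E x y = (y == c x) || (x == c y),
        forall x, porbit c x = setT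
      & forall x, c (c x) != x].
Proof.
case/card_gt0P=> x0 _.
have [y0 Exy0] : exists y0, E x0 y0.
  have /card_gt0P[y] : (0 < #|[set y | E x0 y]|)%N by rewrite Ereg.
  by rewrite inE; exists y.
pose O := porbit next (x0, y0).
have OE x y : (x, y) \in O -> E x y.
  by case/porbitP=> m def_xy; have := next_darts (x0, y0) m; rewrite -def_xy /= Exy0.
have Onext x y : (x, y) \in O -> (y, other y x) \in O.
  move=> Oxy; have: next (x, y) \in O.
    by have:= Oxy; rewrite /O -!eq_porbit_mem => /eqP<-; rewrite eq_porbit_mem perm_in_porbit.
  by rewrite permE /dart_step /= (OE _ _ Oxy).
have Orev x y : (x, y) \in O -> (y, x) \notin O.
  move=> Oxy; apply/negP; have:= Oxy; rewrite {1}/O -eq_porbit_mem => /eqP eqO.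
  rewrite /O -eqO => /porbitP[m def_yx].
  by have /(_ (OE _ _ Oxy))/eqP := @reverse_notin_orbit m (x, y); rewrite -def_yx.
have Opred x y : (x, y) \in O -> (other x y, x) \in O.
  move=> Oxy; case def_z: ((next^-1)%g (x, y)) => [z x'].
  have nextz: next (z, x') = (x, y) by rewrite -def_z permKV.
  have Oz: (z, x') \in O.
    move: Oxy; rewrite -nextz /O -!eq_porbit_mem => /eqP<-.
    by rewrite eq_porbit_mem porbit_sym perm_in_porbit.
  move: nextz; rewrite permE /dart_step /= (OE _ _ Oz) => -[eq_x' <-].
  by rewrite -eq_x' otherK // Esym (OE _ _ Oz).
have Ouniq x y y' : (x, y) \in O -> (x, y') \in O -> y = y'.
  move=> Oxy Oxy'; have [_ _ oP] := otherP (OE _ _ Oxy).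
  case: (oP y' (OE _ _ Oxy')) => // def_y'.
  by have /Orev := Opred _ _ Oxy; rewrite -def_y' Oxy'.
have Oex x : exists y, (x, y) \in O.
  pose V := [pred x | [exists y, (x, y) \in O]]; have: (x0 \in V) = (x \in V).
    apply: (@closed_connect _ E) (Econ x0 x); apply: intro_closed => [|u w Euw].
      exact: sym_connect_sym.
    rewrite !inE => /existsP[y Ouy]; apply/existsP.
    have [_ _ oP] := otherP (OE _ _ Ouy).
    by case: (oP w Euw) => ->; [exists (other y u); exact: Onext | exists u; exact: Opred].
  rewrite !inE => eqE; apply/existsP; rewrite -eqE; apply/existsP; exists y0.
  by rewrite /O porbit_id.
pose c x := xchoose (Oex x).
have Oc x : (x, c x) \in O by exact: (xchooseP (Oex x)).
have cE x y : (x, y) \in O -> c x = y by move=> Oxy; exact: Ouniq (Oc x) Oxy.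
have oc x : other (c x) (c (c x)) = x.
  rewrite (cE _ _ (Onext _ _ (Oc x))) otherK // Esym; exact: OE.
have c_inj : injective c by move=> x y eq_c; rewrite -[x]oc eq_c oc.
have EcP x y : E x y = (y == c x) || (x == c y).
  apply/idP/orP => [Exy|[]/eqP->]; last 2 first.
  - exact: OE (Oc x).
  - by rewrite Esym; apply: OE (Oc y).
  have [_ _ oP] := otherP (OE _ _ (Oc x)).
  case: (oP y Exy) => [->|def_y]; first by left.
  by right; rewrite def_y (cE _ _ (Opred _ _ (Oc x))).
exists (perm c_inj); split=> [x y|x|x]; rewrite ?permE //; last first.
  apply/eqP=> ccx; have := Oc (c x); rewrite ccx; apply/negP; exact: Orev.
apply/setP=> y; rewrite inE.
have <-: (x \in porbit (perm c_inj) x) = (y \in porbit (perm c_inj) x).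
  apply: (@closed_connect _ E) (Econ x y); move=> u w.
  rewrite EcP -!eq_porbit_mem.
  have pc v : porbit (perm c_inj) (c v) = porbit (perm c_inj) v.
    apply/eqP; rewrite eq_porbit_mem porbit_sym -[c v](permE c_inj).
    by rewrite porbit_sym perm_in_porbit.
  by case/orP=> /eqP->; rewrite pc.
exact: porbit_id.
Qed.
End CyclicOrder.

Section PermutationsOfACycle.
Variables (T : finType) (c : {perm T}).
Hypothesis c_trans : forall x, porbit c x = setT.

(** A permutation moving along the cycle that takes one forward step without
    coming back is forced to go on: at c x it cannot stay, as s x = c x is
    already a value, and cannot go back to x either. *)
Lemma eq_of_turn (s : {perm T}) x0 :
  (forall x, [\/ s x = x, s x = c x | c (s x) = x]) ->
  s x0 = c x0 -> s (s x0) <> x0 -> s = c.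
Proof.
move=> s_adj sx0 ssx0.
have step x : s x = c x /\ s (s x) <> x -> s (c x) = c (c x) /\ s (s (c x)) <> c x.
  case=> sx ssx.
  have scx : s (c x) = c (c x).
    case: (s_adj (c x)) => [e|//|/perm_inj e]; last by case: ssx; rewrite sx.
    have /perm_inj fx : s (c x) = s x by rewrite e.
    by case: ssx; rewrite sx fx sx fx.
  split=> // e; case: ssx; rewrite sx; apply: (@perm_inj _ s).
  by rewrite e sx.
apply/permP=> x; have: x \in porbit c x0 by rewrite c_trans inE.
case/porbitP=> m ->.
have: s ((c ^+ m)%g x0) = c ((c ^+ m)%g x0) /\ s (s ((c ^+ m)%g x0)) <> (c ^+ m)%g x0.
  by elim: m => [|m IHm]; rewrite ?expg0 ?perm1 // expgSr !permM; apply: step.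
by case.
Qed.

End PermutationsOfACycle.

Lemma perm_of_cycle_cases (T : finType) (c s : {perm T}) :
  (forall x, porbit c x = setT) ->
  (forall x, [\/ s x = x, s x = c x | c (s x) = x]) ->
  [\/ forall x, s (s x) = x, s = c | s = (c^-1)%g].
Proof.
move=> c_trans s_adj.
have [/forallP inv_s|] := boolP [forall x, s (s x) == x].
  by constructor 1 => x; apply/eqP.
case/forallPn=> x /eqP ssx; case: (s_adj x) => [sx|sx|sx].
- by case: ssx; rewrite !sx.
- by constructor 2; apply: eq_of_turn sx ssx.
constructor 3; apply: (eq_of_turn _ _ _ ssx).
- by move=> y; rewrite porbitV.
- move=> y; case: (s_adj y) => [|sy|sy]; [by constructor 1 | constructor 3 | constructor 2].
    by rewrite sy permK.
  by rewrite -{2}sy permK.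
- by rewrite -{2}sx permK.
Qed.

Lemma odd_transitive_perm (T : finType) (c : {perm T}) :
  (0 < #|T|)%N -> (forall x, porbit c x = setT) -> odd_perm c = ~~ odd #|T|.
Proof.
case/card_gt0P=> x0 _ c_trans; rewrite /odd_perm.
suff ->: porbits c = [set setT] by rewrite cards1 addbT.
apply/setP=> A; rewrite inE; apply/imsetP/eqP=> [[x _ ->]|->]; first exact: c_trans.
by exists x0; rewrite ?c_trans.
Qed.

(** An involution is a product of as many disjoint transpositions as half the
    number of points it moves; the induction removes one of them. *)
Lemma odd_involution (T : finType) (s : {perm T}) :
  (forall x, s (s x) = x) -> odd_perm s = odd #|[set x | s x != x]|./2.
Proof.
have [m] := ubnP #|[set x | s x != x]|; elim: m s => // m IHm s le_m inv_s.
case: (pickP (fun x => s x != x)) => [x sx|fix_s]; last first.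
  rewrite (_ : s = 1%g) ?odd_perm1; last first.
    by apply/permP=> x; rewrite perm1; apply/eqP/negPn; rewrite fix_s.
  by rewrite (_ : [set _ | _] = set0) ?cards0 //; apply/setP=> x; rewrite !inE perm1 eqxx.
pose t := (tperm x (s x) * s)%g.
have tE y : t y = if (y == x) || (y == s x) then y else s y.
  rewrite permM; case: tpermP => [->|->|/eqP/negPf-> /eqP/negPf->] //.
    by rewrite eqxx inv_s.
  by rewrite eqxx orbT.
have inv_t y : t (t y) = y.
  rewrite [t y]tE; case: ifP => [yx|/norP[yx ysx]]; first by rewrite tE yx.
  rewrite tE inv_s (inj_eq perm_inj) (negPf yx) orbF ifN //.
  by apply: contra_neq ysx => <-; rewrite inv_s.
have supp_t : [set y | s y != y] = [set x; s x] :|: [set y | t y != y].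
  apply/setP=> y; rewrite !inE tE; case: (eqVneq y x) => [->|yx] /=; first exact: sx.
  by case: (eqVneq y (s x)) => [->|ysx] //=; rewrite inv_s eq_sym; exact: sx.
have card_s : #|[set y | s y != y]| = #|[set y | t y != y]|.+2.
  rewrite supp_t cardsU cards2 eq_sym sx.
  rewrite (_ : _ :&: _ = set0) ?cards0 ?subn0 //.
  by apply/setP=> y; rewrite !inE tE; case: ifP; rewrite ?eqxx.
have -> : s = (tperm x (s x) * t)%g by rewrite mulgA tperm2 mul1g.
rewrite odd_permM odd_tperm eq_sym sx {1}IHm //; last first.
  by move: le_m; rewrite card_s ltnS; exact: ltnW.
by rewrite (_ : (tperm x (s x) * t)%g = s) ?card_s // mulgA tperm2 mul1g.
Qed.

(** Only permutations moving along the cycle contribute to the Leibniz formula.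
    Besides involutions these are c and its inverse, which contribute the same
    product by symmetry of M, each with the sign (-1)^(k+1) of a k-cycle. *)
Lemma det_of_cycle (R : comNzRingType) k (M : 'M[R]_k) (c : 'S_k) :
    (0 < k)%N -> M^T = M -> (forall i, porbit c i = setT) ->
    (forall i, c (c i) != i) ->
    (forall i j, i != j -> M i j != 0 -> (j == c i) || (i == c j)) ->
  \det M =
    \sum_(s : 'S_k | [forall i, s (s i) == i]
                     && [forall i, (s i == i) || ((s i == c i) || (i == c (s i)))])
      (-1) ^+ s * \prod_i M i (s i)
    + 2 * ((-1) ^+ k.+1 * \prod_i M i (c i)).
Proof.
move=> k_gt0 symM c_trans ccD Mc; have symMij i j : M i j = M j i by rewrite -{1}symM mxE.
pose inv (s : 'S_k) := [forall i, s (s i) == i].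
have sign_c : (-1) ^+ c = (-1) ^+ k.+1 :> R.
  by rewrite odd_transitive_perm ?card_ord // -[RHS]signr_odd.
have vanish (s : 'S_k) i : s i != i -> ~~ ((s i == c i) || (i == c (s i))) ->
    (-1) ^+ s * \prod_i M i (s i) = 0.
  move=> si nadj; rewrite (bigD1 i) //= [M i (s i)](_ : _ = 0) ?mul0r ?mulr0 //.
  by apply/eqP; apply: contraNT nadj => /Mc; apply; rewrite eq_sym.
have ninv (s : 'S_k) : ~~ inv s -> s != c -> s != (c^-1)%g ->
    (-1) ^+ s * \prod_i M i (s i) = 0.
  move=> Ns sc scV.
  have [/forallP adj_s|] :=
    boolP [forall i, (s i == i) || ((s i == c i) || (i == c (s i)))].
    case: (@perm_of_cycle_cases _ c s c_trans) => [x|inv_s|e|e].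
    - by case/or3P: (adj_s x) => /eqP; [constructor 1 | constructor 2 | constructor 3].
    - by case/negP: Ns; apply/forallP=> i; rewrite inv_s.
    - by rewrite e eqxx in sc.
    - by rewrite e eqxx in scV.
  by case/forallPn=> i; rewrite negb_or => /andP[]; exact: vanish.
have k0 := Ordinal k_gt0.
have cNinv : ~~ inv c by apply/forallPn; exists k0; exact: ccD.
have c_cV : c != (c^-1)%g.
  by apply/negP=> /eqP e; have := ccD k0; rewrite {1}e permK eqxx.
have cVNinv : ~~ inv (c^-1)%g.
  apply/forallPn; exists k0; apply/negP=> /eqP e.
  by have := ccD k0; rewrite -[in X in X != _]e !permKV eqxx.
rewrite /determinant (bigID inv) /=; congr (_ + _).
  rewrite (bigID (fun s : 'S_k => [forall i, (s i == i) || ((s i == c i) || (i == c (s i)))])) /=.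
  rewrite [X in _ + X]big1 ?addr0 // => s /andP[_ /forallPn[i]].
  by rewrite negb_or => /andP[]; exact: vanish.
rewrite (bigD1 c) //= (bigD1 (c^-1)%g) /=; last by rewrite cVNinv eq_sym.
rewrite [X in _ + (_ + X)]big1; last first.
  by move=> s /andP[/andP[Ns sc] scV]; exact: ninv.
rewrite addr0 odd_permV mulr_natl mulr2n sign_c; congr (_ + _ * _).
rewrite (reindex_inj (@perm_inj _ c)) /=; apply: eq_bigr => i _.
by rewrite permK symMij.
Qed.

Lemma set2_eq (T : finType) (a b x y : T) :
  [set a; b] = [set x; y] -> (a = x /\ b = y) \/ (a = y /\ b = x).
Proof.
move/setP=> E; have := E x; have := E y; have := E b; have := E a.
rewrite !inE !eqxx ?orbT /= => /esym/orP[]/eqP ax /esym/orP[]/eqP bx; rewrite ax bx.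
- by move=> /orP[]/eqP->; auto.
- by auto.
- by auto.
- by move=> _ /orP[]/eqP->; auto.
Qed.

(** * Involutions and matchings *)

Section InvolutionsAndMatchings.
Variables (N k : nat) (e : 'I_k -> 'I_N).
Hypothesis e_inj : injective e.
Implicit Types (s : 'S_k) (M : {set {set 'I_N}}).

Definition is_involution s := [forall i, s (s i) == i].

Lemma is_involutionP s : reflect (forall i, s (s i) = i) (is_involution s).
Proof. by apply: (iffP forallP) => inv_s i; apply/eqP. Qed.

Definition moved_pairs s : {set {set 'I_N}} :=
  [set [set e i; e (s i)] | i in [pred i | s i != i]].

Lemma mem_moved_pairs s i j : is_involution s -> i != j ->
  ([set e i; e j] \in moved_pairs s) = (s i == j).
Proof.
move=> /is_involutionP inv_s ij; apply/imsetP/eqP => [[i' _]|def_j]; last first.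
  by exists i; rewrite ?def_j // inE def_j eq_sym.
by case/set2_eq=> -[/e_inj-> /e_inj->].
Qed.

Lemma moved_pairs_inj s s' : is_involution s -> is_involution s' ->
  moved_pairs s = moved_pairs s' -> s = s'.
Proof.
move=> inv_s inv_s' eq_ss'.
have sub t t' i : is_involution t -> is_involution t' -> moved_pairs t = moved_pairs t' ->
    t i != i -> t' i = t i.
  move=> inv_t inv_t' eq_tt' ti; apply/eqP.
  by rewrite -mem_moved_pairs // 1?eq_sym // -eq_tt' mem_moved_pairs // eq_sym.
apply/permP=> i; have [si|si] := eqVneq (s i) i; last by rewrite -(sub s s').
by have [-> //|s'i] := eqVneq (s' i) i; rewrite -(sub s' s).
Qed.

Section BigMoved.
Variables (V : Type) (idx : V) (op : Monoid.com_law idx).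

(** Grouping the moved points by the pair they form with their image. It serves
    for products of entries as well as for counting, whence the general monoid. *)
Lemma big_moved_pairs s (f : 'I_k -> V) (h : {set 'I_N} -> V) : is_involution s ->
    (forall i, s i != i -> op (f i) (f (s i)) = h [set e i; e (s i)]) ->
  \big[op/idx]_(i | s i != i) f i = \big[op/idx]_(x in moved_pairs s) h x.
Proof.
move=> /is_involutionP inv_s fh.
rewrite (partition_big (fun i => [set e i; e (s i)]) (mem (moved_pairs s))) /=; last first.
  by move=> i si; apply/imsetP; exists i.
apply: eq_bigr => x /imsetP[i si ->]; rewrite inE in si.
rewrite (bigD1 i) ?si ?eqxx //= (bigD1 (s i)) /=; last first.
  by rewrite inv_s eq_sym si setUC eqxx.
rewrite big1 ?Monoid.mulm1 -?fh // => j /andP[/andP[/andP[_ /eqP eq_j] ji] jsi].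
by case/set2_eq: eq_j ji jsi => -[/e_inj-> _]; rewrite eqxx.
Qed.

End BigMoved.

Lemma odd_is_involution s : is_involution s -> odd_perm s = odd #|moved_pairs s|.
Proof.
move=> inv_s; rewrite odd_involution; last exact/is_involutionP.
congr (odd _); rewrite -[RHS]half_double; congr (_./2).
rewrite -sum1_card -muln2 -sum_nat_const -(big_moved_pairs (f := fun=> 1%N)) //.
by apply: eq_bigl => i; rewrite inE.
Qed.

Lemma trivIset_moved_pairs s : is_involution s -> trivIset (moved_pairs s).
Proof.
move=> /is_involutionP inv_s.
have in_pair v i : v \in [set e i; e (s i)] ->
    exists2 w, v = e w & [set e i; e (s i)] = [set e w; e (s w)].
  by rewrite !inE => /orP[]/eqP->; [exists i | exists (s i); rewrite // inv_s setUC].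
apply/trivIsetP=> A B /imsetP[i _ ->] /imsetP[j _ ->]; apply: contraNT.
case/pred0Pn=> v /andP[/= /in_pair[w -> ->] /in_pair[w' /e_inj-> ->]].
exact: eqxx.
Qed.

Lemma cover_moved_pairs s : is_involution s ->
  e @: [set: 'I_k] :\: cover (moved_pairs s) = e @: [set i | s i == i].
Proof.
move=> /is_involutionP inv_s; apply/setP=> v; rewrite !inE; apply/andP/imsetP.
  case=> vN /imsetP[i _ def_v]; exists i => //; rewrite inE.
  apply: contraNT vN => si; apply/bigcupP; exists [set e i; e (s i)].
    by apply/imsetP; exists i.
  by rewrite def_v !inE eqxx.
case=> i; rewrite inE => /eqP si ->; split; last by rewrite imset_f ?inE.
apply/bigcupP=> -[x /imsetP[j]]; rewrite inE => sj ->; rewrite !inE !(inj_eq e_inj).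
by case/orP=> /eqP def_i; case/eqP: sj; move: si; rewrite def_i ?inv_s.
Qed.

Variable G : {set {set 'I_N}}.
Hypothesis G_pairs : forall x, x \in G -> #|x| = 2%N.

Definition moves_along s := [forall i, (s i == i) || ([set e i; e (s i)] \in G)].

Lemma moved_pairs_matching s : is_involution s -> moves_along s ->
  moved_pairs s \in matchings G (e @: [set: 'I_k]).
Proof.
move=> inv_s /forallP along_s; rewrite inE trivIset_moved_pairs // andbT.
apply/subsetP=> x /imsetP[i]; rewrite !inE => si ->.
have := along_s i; rewrite (negPf si) /= => ->.
by apply/subsetP=> v; rewrite !inE => /orP[]/eqP->; rewrite imset_f.
Qed.

(** The involution attached to a matching exchanges the ends of each of its
    edges; disjointness of the edges makes the partner of a vertex unique. *)
Lemma matching_moved_pairs M : M \in matchings G (e @: [set: 'I_k]) ->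
  exists s, [/\ is_involution s, moves_along s & moved_pairs s = M].
Proof.
rewrite inE => /andP[/subsetP subM /trivIsetP trivM].
pose p i := odflt i [pick j | (j != i) && ([set e i; e j] \in M)].
have pP i j : i != j -> [set e i; e j] \in M -> p i = j.
  rewrite /p => ij Mij; case: pickP => [j' /andP[j'i Mij'] /=|/(_ j)]; last first.
    by rewrite eq_sym ij Mij.
  have eq_jj' : [set e i; e j] = [set e i; e j'].
    apply/eqP; apply: contraT => /(trivM _ _ Mij Mij')/pred0P/(_ (e i)).
    by rewrite /= !inE eqxx.
  case/set2_eq: eq_jj' => -[/e_inj def_i /e_inj def_j]; first by [].
  by rewrite def_i eqxx in j'i.
have pM i : p i != i -> [set e i; e (p i)] \in M.
  by rewrite /p; case: pickP => [j /andP[]|_] //=; rewrite eqxx.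
have pK : cancel p p.
  move=> i; have [pi|pi] := eqVneq (p i) i; first by rewrite !pi.
  by apply: pP => //; rewrite setUC pM.
pose s := perm (can_inj pK); have sE i : s i = p i by rewrite permE.
exists s; split; first by apply/is_involutionP=> i; rewrite !sE pK.
  apply/forallP=> i; rewrite sE; have [//|pi] := eqVneq (p i) i.
  by have := subM _ (pM _ pi); rewrite inE => /andP[].
apply/setP=> x; apply/imsetP/idP => [[i]|Mx].
  by rewrite !inE !sE => /pM ? ->.
have := subM _ Mx; rewrite inE => /andP[Gx xS].
have /eqP/cards2P[u [v [uv def_x]]] := G_pairs Gx.
have := xS; rewrite def_x subUset !sub1set => /andP[/imsetP[i _ def_u] /imsetP[j _ def_v]].
have ij : i != j by apply: contraNneq uv => ij; rewrite def_u def_v ij.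
have pij : p i = j by apply: pP; rewrite // -def_u -def_v -def_x.
by exists i; rewrite ?inE sE pij ?def_u ?def_v // eq_sym.
Qed.

(** For symmetric F this is the common value F i j = F j i at an edge {i, j},
    written without choosing an end of the edge. *)
Definition edge_weight (R : comNzRingType) (F : 'I_N -> 'I_N -> R) (x : {set 'I_N}) : R :=
  \prod_(j < N) \prod_(k < N | (j < k)%N && ([set j; k] == x)) F j k.

Lemma edge_weightE (R : comNzRingType) (F : 'I_N -> 'I_N -> R) i j :
  (forall i j, F i j = F j i) -> i != j -> edge_weight F [set i; j] = F i j.
Proof.
move=> symF; wlog lt_ij : i j / (i < j)%N.
  move=> IH ij; have [lt_ij|gt_ij|/val_inj/eqP] := ltngtP i j; last by rewrite (negPf ij).
    exact: IH.
  by rewrite setUC symF IH // eq_sym.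
move=> ij; rewrite /edge_weight pair_big_dep /= (big_pred1 (i, j)) // => -[u v] /=.
apply/andP/eqP => [[lt_uv /eqP/set2_eq[[-> ->]//|[eu ev]]]|[-> ->]]; last by [].
by rewrite eu ev ltnNge ltnW in lt_uv.
Qed.

Lemma edge_prodE (R : comNzRingType) (F : 'I_N -> 'I_N -> R) M :
  \prod_(j < N) \prod_(k < N | (j < k)%N && ([set j; k] \in M)) F j k
    = \prod_(x in M) edge_weight F x.
Proof.
rewrite pair_big_dep /= (partition_big (fun p => [set p.1; p.2]) (mem M)) /=; last first.
  by move=> p /andP[].
apply: eq_bigr => x Mx; rewrite /edge_weight pair_big_dep; apply: eq_bigl => p /=.
by rewrite andbAC -!andbA; case: eqP => [->|]; rewrite ?andbF ?Mx.
Qed.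

(** Involutions moving along edges of G correspond to matchings of G, the moved
    pairs being the edges of the matching: each of these contributes a factor
    -1 to the sign and F i j F j i to the product, and each uncovered vertex
    contributes a diagonal entry. *)
Lemma sum_involutions (R : comNzRingType) (F : 'I_N -> 'I_N -> R) :
    (forall i j, F i j = F j i) ->
  \sum_(s : 'S_k | is_involution s && moves_along s)
     (-1) ^+ s * \prod_i F (e i) (e (s i))
  = \sum_(M in matchings G (e @: [set: 'I_k]))
     (-1) ^+ #|M|
     * (\prod_(j < N) \prod_(k < N | (j < k)%N && ([set j; k] \in M)) F j k ^+ 2)
     * \prod_(j in (e @: [set: 'I_k]) :\: cover M) F j j.
Proof.
move=> symF.
rewrite (partition_big moved_pairs (mem (matchings G (e @: [set: 'I_k])))) /=; last first.
  by move=> s /andP[]; exact: moved_pairs_matching.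
apply: eq_bigr => M /matching_moved_pairs[s [inv_s along_s def_M]].
rewrite (big_pred1 s) => [|s']; last first.
  apply/andP/eqP => [[/andP[inv_s' _] /eqP eq_M]|->]; last by rewrite inv_s along_s def_M.
  by apply: moved_pairs_inj; rewrite // eq_M.
rewrite odd_is_involution // signr_odd -def_M edge_prodE -mulrA; congr (_ * _).
rewrite (bigID (fun i => s i != i)) /=; congr (_ * _).
  apply: (big_moved_pairs inv_s) => i si.
  have esi : e i != e (s i) by rewrite (inj_eq e_inj) eq_sym.
  rewrite (@edge_weightE _ (fun j k => F j k ^+ 2)) //=; last by move=> u v; rewrite symF.
  by rewrite (is_involutionP _ inv_s) [F (e (s i)) _]symF expr2.
rewrite cover_moved_pairs // big_imset /=; last by move=> i j _ _; exact: e_inj.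
rewrite (eq_bigl (fun i => s i == i)) => [|i]; last by rewrite negbK.
by rewrite [RHS](eq_bigl (fun i => s i == i)) => [|i]; [apply: eq_bigr => i /eqP-> | rewrite inE].
Qed.

End InvolutionsAndMatchings.

(** * The determinant of an induced cycle *)

Lemma mem_graph_of (R : realDomainType) N (K : 'M[R]_N) i j : K^T = K -> i != j ->
  ([set i; j] \in graph_of K) = (K i j != 0).
Proof.
move=> symK ij; apply/imset2P/idP => [[u v _]|Kij]; last first.
  by exists i j; rewrite ?inE // ij.
rewrite inE => /andP[_ /andP[uv Kuv]] /set2_eq[[-> ->] //|[-> ->]].
by rewrite -[K]symK mxE.
Qed.

Lemma graph_of_pairs (R : realDomainType) N (K : 'M[R]_N) x :
  x \in graph_of K -> #|x| = 2%N.
Proof. by case/imset2P=> i j _; rewrite inE => /andP[_ /andP[ij _]] ->; rewrite cards2 ij. Qed.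

Lemma imset_enum_val (T : finType) (A : {set T}) :
  (@enum_val _ (mem A)) @: [set: 'I_#|A|] = A.
Proof.
apply/setP=> v; apply/imsetP/idP => [[i _ ->]|Av]; first exact: enum_valP.
by exists (enum_rank_in Av v); rewrite ?inE // enum_rankK_in.
Qed.

Section CyclesOfAGraph.
Variables (N : nat) (G C : {set {set 'I_N}}).
Hypothesis G_pairs : forall x, x \in G -> #|x| = 2%N.
Hypothesis cycC : simple_cycle G C.
Hypothesis C_neq0 : C != set0.

Let k := #|cover C|.
Let e : 'I_k -> 'I_N := @enum_val _ (mem (cover C)).

(** Transfers [cyclic_order] to the graph C, with vertices numbered by e: C is
    2-regular because its nonzero degrees are two, and connected by definition. *)
Lemma simple_cycle_order :
  exists c : 'S_k,
    [/\ forall i, porbit c i = setT, forall i, c (c i) != i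
      & forall i j, ([set e i; e j] \in C) = (j == c i) || (i == c j)].
Proof.
have e_inj : injective e by exact: enum_val_inj.
case/andP: cycC => /and3P[/subsetP sCG _ /forallP conC] /forallP deg2.
have pairC i j : [set e i; e j] \in C -> i != j.
  by move/sCG/G_pairs; rewrite cards2 (inj_eq e_inj); case: eqP.
pose E := [rel i j | [set e i; e j] \in C].
have Cpart x v : x \in C -> v \in x -> exists w, w != v /\ x = [set v; w].
  move=> Cx; have /eqP/cards2P[a [b [ab ->]]] := G_pairs (sCG x Cx).
  rewrite !inE => /orP[]/eqP->; first by exists b; rewrite eq_sym.
  by exists a; rewrite setUC.
have eC w x : x \in C -> w \in x -> exists i, w = e i.
  move=> Cx xw; have: w \in cover C by apply/bigcupP; exists x.
  by rewrite -[cover C]imset_enum_val => /imsetP[i _ ->]; exists i.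
have Esym : symmetric E by move=> i j; rewrite /= setUC.
have Eirr : irreflexive E by move=> i; apply/negbTE/negP => /pairC; rewrite eqxx.
have Ereg i : #|[set j | E i j]| = 2%N.
  have <- : degree C (e i) = 2%N.
    apply/eqP; apply: (implyP (deg2 (e i))); rewrite -lt0n card_gt0.
    have /bigcupP[x Cx xi] : e i \in cover C by exact: enum_valP.
    by apply/set0Pn; exists x; rewrite inE Cx.
  rewrite /degree -(@card_in_imset _ _ (fun j => [set e i; e j])); last first.
    move=> j j'; rewrite !inE => /pairC ij _ /set2_eq[[_ /e_inj//]|[eij /e_inj eji]].
    by rewrite eji eqxx in ij.
  apply: eq_card => x; rewrite inE; apply/imsetP/andP => [[j]|[Cx xi]].
    by rewrite inE => Eij ->; rewrite !inE eqxx.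
  have [w [wi def_x]] := Cpart _ _ Cx xi.
  have [j def_w] : exists j, w = e j by apply: (eC _ _ Cx); rewrite def_x !inE eqxx orbT.
  by exists j; rewrite ?inE -def_w -?def_x.
have Econ i j : connect E i j.
  have /forallP/(_ (e j))/implyP/(_ (enum_valP j)) := implyP (conC (e i)) (enum_valP i).
  set F := rel_of_simpl _ => conF.
  pose a := [pred v | [exists j', (e j' == v) && connect E i j']].
  have: (e i \in a) = (e j \in a).
    apply: (@closed_connect _ F) conF; apply: intro_closed.
      by apply: sym_connect_sym => u v; rewrite /F /= setUC.
    move=> u v Fuv; rewrite !inE => /existsP[j' /andP[/eqP def_u con_j']].
    have [w def_v] : exists w, v = e w by apply: (eC v [set u; v] Fuv); exact: set22.
    apply/existsP; exists w; rewrite def_v eqxx /=; apply: connect_trans con_j' _.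
    by apply: connect1; rewrite /= def_u -def_v.
  rewrite !inE => eq_a; have /existsP[j'] : [exists j', (e j' == e j) && connect E i j'].
    by rewrite -eq_a; apply/existsP; exists i; rewrite eqxx connect0.
  by rewrite (inj_eq e_inj) => /andP[/eqP->].
have k_gt0 : (0 < #|'I_k|)%N.
  rewrite card_ord card_gt0; case/set0Pn: C_neq0 => x Cx.
  have /eqP/cards2P[a [b [_ def_x]]] := G_pairs (sCG x Cx).
  by apply/set0Pn; exists a; apply/bigcupP; exists x; rewrite // def_x !inE eqxx.
have [c [Ec cT cc]] := cyclic_order Esym Eirr Ereg Econ k_gt0.
by exists c; split.
Qed.

(** A rotation without 2-cycles passes through every edge of C exactly once. *)
Lemma simple_cycle_edges (c : 'S_k) :
    (forall i, c (c i) != i) ->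
    (forall i j, ([set e i; e j] \in C) = (j == c i) || (i == c j)) ->
  C = [set [set e i; e (c i)] | i : 'I_k] /\ injective (fun i => [set e i; e (c i)]).
Proof.
move=> cc Cc; have e_inj : injective e by exact: enum_val_inj.
case/andP: cycC => /and3P[/subsetP sCG _ _] _; split; last first.
  move=> i j /set2_eq[[/e_inj//]|[/e_inj-> /e_inj eq_c]].
  by have := cc j; rewrite eq_c eqxx.
apply/setP=> x; apply/idP/imsetP => [Cx|[i _ ->]]; last by rewrite Cc eqxx.
have /eqP/cards2P[a [b [_ def_x]]] := G_pairs (sCG x Cx).
have [i def_a] : exists i, a = e i.
  have : a \in cover C by apply/bigcupP; exists x; rewrite // def_x !inE eqxx.
  by rewrite -[cover C]imset_enum_val => /imsetP[i _ ->]; exists i.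
have [j def_b] : exists i, b = e i.
  have : b \in cover C by apply/bigcupP; exists x; rewrite // def_x !inE eqxx orbT.
  by rewrite -[cover C]imset_enum_val => /imsetP[j _ ->]; exists j.
have := Cx; rewrite def_x def_a def_b Cc => /orP[]/eqP->; first by exists i.
by exists j => //; exact: setUC.
Qed.

Lemma card_simple_cycle : #|C| = #|cover C|.
Proof.
have [c [_ cc Cc]] := simple_cycle_order; have [edgC c_inj] := simple_cycle_edges cc Cc.
by rewrite {1}edgC card_imset // card_ord.
Qed.

Lemma simple_cycle_gt2 : (2 < #|C|)%N.
Proof.
have [c [_ cc Cc]] := simple_cycle_order; rewrite card_simple_cycle.
have [v Cv] : exists v, v \in cover C.
  apply/set0Pn; rewrite -card_gt0 -card_simple_cycle card_gt0; exact: C_neq0.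
pose i := enum_rank_in Cv v.
have ci (j : 'I_k) : c j != j by apply: contraNneq (cc j) => cj; rewrite cj cj.
have: (#|[set i; c i; c (c i)]| <= #|'I_k|)%N by exact: max_card.
rewrite card_ord; apply: leq_trans; rewrite -setUA cardsU1 cards2 !inE.
by rewrite ![i == _]eq_sym [c i == c _]eq_sym (negPf (ci i)) (negPf (ci (c i))) (negPf (cc i)).
Qed.

End CyclesOfAGraph.

(** As C is induced, the nonzero off-diagonal entries of the principal submatrix
    are the edges of C, so that [det_of_cycle] applies with a rotation of C. *)
Theorem det_induced_cycle (R : realDomainType) N (K : 'M[R]_N) (C : {set {set 'I_N}}) :
    K^T = K -> induced_cycle (graph_of K) C -> C != set0 ->
  \det (principal K (cover C)) =
    \sum_(M in matchings (graph_of K) (cover C))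
      (-1) ^+ #|M|
      * (\prod_(j < N) \prod_(k < N | (j < k)%N && ([set j; k] \in M)) K j k ^+ 2)
      * \prod_(j in cover C :\: cover M) K j j
    + 2 * ((-1) ^+ #|C|.+1 * \prod_(x in C) edge_weight K x).
Proof.
move=> symK /andP[cycC /eqP indC] C0; have G_pairs := @graph_of_pairs R N K.
have [c [cT cc Cc]] := simple_cycle_order G_pairs cycC C0.
have [edgC c_inj] := simple_cycle_edges G_pairs cycC cc Cc.
have cardC := card_simple_cycle G_pairs cycC C0.
have k_gt0 : (0 < #|cover C|)%N by rewrite -cardC card_gt0.
set e := @enum_val _ (mem (cover C)) in cc Cc edgC c_inj.
have e_inj : injective e by exact: enum_val_inj.
have symKij i j : K i j = K j i by rewrite -{1}symK mxE.
have KE i j : principal K (cover C) i j = K (e i) (e j) by rewrite mxE.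
have GC i j : ([set e i; e j] \in graph_of K) = ([set e i; e j] \in C).
  rewrite [in RHS]indC inE andbC (_ : _ \subset _) //.
  by apply/subsetP=> v; rewrite !inE => /orP[]/eqP->; exact: enum_valP.
rewrite (det_of_cycle (c := c)) //; first last.
- move=> i j ij; rewrite KE -mem_graph_of ?(inj_eq e_inj) // GC Cc //.
- by apply/matrixP=> i j; rewrite mxE !KE symKij.
congr (_ + _ * (_ * _)); last first.
- rewrite [in RHS]edgC big_imset /=; last by move=> i j _ _; exact: c_inj.
  apply: eq_big => // i _; rewrite edge_weightE ?KE // (inj_eq e_inj).
  by apply: contraNneq (cc i) => ic; rewrite -!ic.
- by rewrite cardC.
have := sum_involutions e_inj (@G_pairs) symKij; rewrite imset_enum_val => <-.
apply: eq_big => [s|s _]; last by congr (_ * _); apply: eq_bigr => i _; rewrite KE.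
by congr (_ && _); apply: eq_forallb => i; rewrite GC Cc.
Qed.

(** * Vectors orthogonal to the cycle space *)

Lemma natrF2_eq0 n : (n%:R == 0 :> 'F_2) = ~~ odd n.
Proof. by rewrite -val_eqE /= val_Fp_nat // modn2; case: (odd n). Qed.

Lemma F2_cases (a : 'F_2) : a = 0 \/ a = 1.
Proof. by case: a => -[|[|]] // a_lt; [left | right]; apply: val_inj. Qed.

Section CycleSpaceOrthogonal.
Variables (N : nat) (G : {set {set 'I_N}}) (z : 'rV['F_2]_#|G|).
Hypothesis G_pairs : forall x, x \in G -> #|x| = 2%N.

Lemma cycle_space_orthogonal (Cs : seq {set {set 'I_N}}) :
    cycle_basis G Cs ->
    (forall C, C \in Cs -> z *m (incidence G C)^T = 0) ->
  forall C, is_cycle G C -> z *m (incidence G C)^T = 0.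
Proof.
case/andP=> /andP[/eqP span_Cs _] _ zCs C cycC.
pose f := linfun (mulmxr z^T : 'rV['F_2]_#|G| -> 'M_1).
have fE w : f w = (z *m w^T)^T by rewrite lfunE /= trmx_mul trmxK.
have: incidence G C \in lker f.
  have sub_ker : (cycle_space G <= lker f)%VS.
    rewrite -span_Cs; apply/span_subvP=> w /mapP[D CsD ->].
    by rewrite memv_ker fE zCs ?trmx0.
  by apply: (subvP sub_ker); apply/memv_span/imageP; exists C.
by rewrite memv_ker fE => /eqP/(congr1 trmx); rewrite trmxK trmx0.
Qed.

Hypothesis z_cycles : forall C, is_cycle G C -> z *m (incidence G C)^T = 0.

(** A subgraph with even degrees is a disjoint union of connected ones, which
    are cycles. The induction splits off the component D of one edge of C: its
    degrees are those of C on the component and zero elsewhere. *)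
Lemma even_subgraph_orthogonal (C : {set {set 'I_N}}) :
  C \subset G -> (forall v, ~~ odd (degree C v)) -> z *m (incidence G C)^T = 0.
Proof.
have [m] := ubnP #|C|; elim: m C => // m IHm C le_m sCG evC.
have [->|[x Cx]] := set_0Vmem C.
  by rewrite [incidence _ _](_ : _ = 0) ?trmx0 ?mulmx0 //; apply/rowP=> r; rewrite !mxE inE.
have ends y : y \in C -> exists a b, a != b /\ y = [set a; b].
  by move=> Cy; have /eqP/cards2P := G_pairs (subsetP sCG _ Cy).
have [a [b [ab def_x]]] := ends x Cx.
pose F := [rel u v : 'I_N | [set u; v] \in C].
have Fsym : connect_sym F by apply: sym_connect_sym => u v; rewrite /F /= setUC.
pose D := [set y in C | [exists v in y, connect F a v]].
have sDC : D \subset C by apply/subsetP=> y; rewrite inE => /andP[].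
have memD y v : y \in C -> v \in y -> (y \in D) = connect F a v.
  move=> Cy yv; rewrite inE Cy; apply/existsP/idP => [[w /andP[yw con_w]]|con_v]; last first.
    by exists v; rewrite yv.
  apply: connect_trans con_w _; have [->|wv] := eqVneq w v; first exact: connect0.
  apply: connect1; rewrite /F /= (_ : [set w; v] = y) //.
  have [u [u' [_ def_y]]] := ends y Cy.
  move: yv yw wv; rewrite def_y !inE => /orP[]/eqP-> /orP[]/eqP->; rewrite ?eqxx //.
  by rewrite setUC.
clearbody D.
have degD v : degree D v = if connect F a v then degree C v else 0%N.
  rewrite /degree; case: ifP => con_v.
    apply: eq_card => y; rewrite inE [RHS]inE.
    have [yv|] := boolP (v \in y); last by rewrite !andbF.
    have [Cy|nCy] := boolP (y \in C); first by rewrite (memD y v) ?con_v.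
    by rewrite (negPf (contraNN (subsetP sDC y) nCy)).
  apply/eqP; rewrite cards_eq0; apply/eqP/setP=> y; rewrite inE in_set0.
  apply/negP=> /andP[Dy yv]; have Cy := subsetP sDC _ Dy.
  by rewrite (memD y v) // con_v in Dy.
have cycD : is_cycle G D.
  apply/and3P; split; first exact: subset_trans sCG.
    by apply/forallP=> v; rewrite degD; case: ifP.
  pose F' := [rel u v : 'I_N | [set u; v] \in D].
  have F'sym : connect_sym F' by apply: sym_connect_sym => u v; rewrite /F' /= setUC.
  have conF' v : v \in cover D -> connect F' a v.
    case/bigcupP=> y Dy yv; have con_v : connect F a v.
      by rewrite -(memD y v) // (subsetP sDC).
    pose p := [pred w | connect F' a w].
    suff: (a \in p) = (v \in p) by rewrite !inE connect0.
    apply: (@closed_connect _ F) con_v; apply: intro_closed => // u w Fuw.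
    rewrite !inE => con_u; have con_au : connect F a u.
      by apply: connect_sub con_u => u' v' /= /(subsetP sDC) Fuv; exact: connect1.
    apply: connect_trans con_u (connect1 _).
    by rewrite /F' /= (memD _ u) // set21.
  apply/forallP=> v; apply/implyP=> Dv; apply/forallP=> w; apply/implyP=> Dw.
  by apply: (connect_trans _ (conF' w Dw)); rewrite F'sym conF'.
have Dx : x \in D by rewrite (memD x a) ?connect0 // def_x set21.
have -> : incidence G C = incidence G D + incidence G (C :\: D).
  apply/rowP=> r; rewrite !mxE !inE.
  by case: (boolP (_ \in D)) => [/(subsetP sDC)->|]; rewrite ?addr0 ?add0r.
rewrite linearD /= mulmxDr z_cycles // add0r; apply: IHm.
- move: le_m; rewrite (cardsD1 x) Cx add1n ltnS; apply: leq_ltn_trans.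
  by apply/subset_leq_card/setDS; rewrite sub1set.
- exact: subset_trans (subsetDl _ _) sCG.
move=> v; suff : (degree (C :\: D) v + degree D v)%N = degree C v.
  move/(congr1 odd); rewrite oddD (negPf (evC v)) degD.
  by case: ifP => _; rewrite ?(negPf (evC v)) addbF => ->.
rewrite /degree -cardsUI [X in (_ + X)%N](_ : _ = 0%N) ?addn0; last first.
  apply/eqP; rewrite cards_eq0; apply/eqP/setP=> y; rewrite !inE.
  by case: (y \in C); case: (y \in D) => //=; rewrite ?andbF.
apply: eq_card => y; rewrite !inE; case: (boolP (y \in D)) => [/(subsetP sDC)->|] //=.
by rewrite orbF.
Qed.

(** The columns of the cokernel of the boundary matrix B are incidence vectors
    of subgraphs with even degrees. Being orthogonal to all of them means lying
    in the row space of B, and the rows of B are the coboundaries of vertices. *)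
Lemma orthogonal_cycles_coboundary :
  exists u : 'I_N -> 'F_2, forall r i j,
    enum_val r = [set i; j] -> i != j -> z 0 r = u i + u j.
Proof.
pose B : 'M['F_2]_(N, #|G|) := \matrix_(v < N, r < #|G|) (v \in enum_val r)%:R.
suff /submxP[u def_z] : (z <= B)%MS.
  exists (u 0) => r i j def_r ij; rewrite def_z mxE.
  rewrite (bigD1 i) //= (bigD1 j) 1?eq_sym //= big1 => [|v /andP[vi vj]]; last first.
    by rewrite mxE def_r !inE (negPf vi) (negPf vj) mulr0.
  by rewrite !mxE def_r !inE !eqxx orbT !mulr1 addr0.
rewrite submxE; apply/eqP/row_matrixP=> i; rewrite ord1 row0 row_id {i}.
apply/rowP=> s; pose w := col s (cokermx B).
have Bw : B *m w = 0 by rewrite /w colE mulmxA mulmx_coker mul0mx.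
pose C := [set enum_val r | r in [pred r | w r 0 != 0]].
have Cr r : (enum_val r \in C) = (w r 0 != 0).
  by rewrite mem_imset ?inE //; exact: enum_val_inj.
have sCG : C \subset G by apply/subsetP=> x /imsetP[r _ ->]; exact: enum_valP.
have wE r : w r 0 = (enum_val r \in C)%:R.
  by rewrite Cr; case: (F2_cases (w r 0)) => ->; rewrite ?eqxx // oner_eq0.
have incC : (incidence G C)^T = w by apply/colP=> r; rewrite mxE [LHS]mxE wE.
have := even_subgraph_orthogonal sCG; rewrite incC => zw.
have: z *m w = 0.
  apply: zw => v; rewrite -natrF2_eq0; apply/eqP.
  have /colP/(_ v) := Bw; rewrite !mxE => <-; rewrite /degree.
  rewrite -sum1_card natr_sum big_mkcond /=.
  rewrite [LHS](_ : _ = \sum_(x in G) ((x \in C) && (v \in x))%:R); last first.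
    rewrite [RHS]big_mkcond; apply: eq_bigr => x _; rewrite inE.
    case: (boolP (x \in G)) => [_|]; first by case: ifP.
    by move/(contraNN (subsetP sCG x))/negPf->.
  rewrite big_enum_val; apply: eq_bigr => r _; rewrite wE mxE.
  by case: (_ \in C); case: (_ \in _); rewrite /= ?mulr0 ?mulr1.
by rewrite /w colE mulmxA -colE => /matrixP/(_ 0 0); rewrite !mxE.
Qed.

End CycleSpaceOrthogonal.

(** * Moments of singletons and pairs *)

(** Two numberings of the same rows and columns differ by one permutation, whose
    sign enters twice. This frees the small determinants below from the
    numbering chosen by [enum_val]. *)
Lemma det_mxsub_image (R : comNzRingType) N k m (K : 'M[R]_N)
    (f : 'I_k -> 'I_N) (g : 'I_m -> 'I_N) :
    injective f -> injective g -> f @: [set: 'I_k] = g @: [set: 'I_m] ->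
  \det (mxsub f f K) = \det (mxsub g g K).
Proof.
move=> f_inj g_inj eq_im.
have eq_km : k = m.
  by have := congr1 (fun A : {set 'I_N} => #|A|) eq_im; rewrite !card_imset // !cardsT !card_ord.
case: m / eq_km g g_inj eq_im => g g_inj eq_im.
have im i : exists j, f i == g j.
  have : f i \in g @: [set: 'I_k] by rewrite -eq_im imset_f ?inE.
  by case/imsetP=> j _ ->; exists j.
pose p i := xchoose (im i); have pE i : f i = g (p i) by exact/eqP/(xchooseP (im i)).
have p_inj : injective p by move=> i j eq_p; apply: f_inj; rewrite !pE eq_p.
have -> : mxsub f f K = row_perm (perm p_inj) (col_perm (perm p_inj) (mxsub g g K)).
  by apply/matrixP=> i j; rewrite !mxE !permE !pE.
rewrite row_permE col_permE !det_mulmx !det_perm odd_permV mulrC -mulrA.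
by rewrite -signr_addb addbb mulr1.
Qed.

Lemma det_principal_image (R : realDomainType) N k (K : 'M[R]_N) (f : 'I_k -> 'I_N) :
  injective f -> \det (principal K (f @: [set: 'I_k])) = \det (mxsub f f K).
Proof.
move=> f_inj; set S := f @: _; pose e := @enum_val _ (mem S).
have -> : principal K S = mxsub e e K by apply/matrixP=> i j; rewrite !mxE.
by apply: det_mxsub_image => //; [exact: enum_val_inj | rewrite imset_enum_val].
Qed.

Lemma det_principal1 (R : realDomainType) N (K : 'M[R]_N) i :
  \det (principal K [set i]) = K i i.
Proof.
have := @det_principal_image R N 1 K (fun=> i); rewrite det_mx11 mxE => <-.
  congr (\det (principal K _)); apply/setP=> v; rewrite inE; apply/eqP/imsetP=> [->|[_ _ ->]//].
  by exists ord0.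
by move=> a b _; rewrite !ord1.
Qed.

Lemma det_principal2 (R : realDomainType) N (K : 'M[R]_N) i j : i != j -> K^T = K ->
  \det (principal K [set i; j]) = K i i * K j j - K i j ^+ 2.
Proof.
move=> ij symK; pose f (a : 'I_2) := if a == 0 then i else j.
have f_inj : injective f.
  move=> a b; rewrite /f; have [->|a0] := eqVneq a 0; have [->|b0] := eqVneq b 0 => //.
  - by move/eqP; rewrite (negPf ij).
  - by move/esym/eqP; rewrite (negPf ij).
  by case: a b a0 b0 => -[|[|]] // ? [[|[|]]] // ? _ _ _; apply: val_inj.
have Kji : K j i = K i j by rewrite -{1}symK mxE.
have -> : K i i * K j j - K i j ^+ 2 = \det (mxsub f f K).
  rewrite (expand_det_row _ ord0) !big_ord_recl big_ord0 /cofactor !det_mx11 !mxE /f /=.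
  by rewrite Kji; ring.
rewrite -det_principal_image //.
congr (\det (principal K _)); apply/setP=> v; rewrite !inE; apply/orP/imsetP.
  by case=> /eqP->; [exists 0 | exists 1].
by case=> a _ ->; rewrite /f; case: ifP => _; rewrite eqxx; [left | right].
Qed.

(** * Stability of the sum over matchings *)

Lemma ler_dist_prod (R : realDomainType) (I : finType) (P : pred I) (a b : I -> R) :
    (forall i, P i -> `|a i| <= 1) -> (forall i, P i -> `|b i| <= 1) ->
  `|\prod_(i | P i) a i - \prod_(i | P i) b i| <= \sum_(i | P i) `|a i - b i|.
Proof.
move=> a1 b1.
suff [//] : [/\ `|\prod_(i | P i) a i - \prod_(i | P i) b i| <= \sum_(i | P i) `|a i - b i|,
    `|\prod_(i | P i) a i| <= 1 & `|\prod_(i | P i) b i| <= 1].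
apply: (big_rec3 (fun u v w => [/\ `|u - v| <= w, `|u| <= 1 & `|v| <= 1])).
  by rewrite subrr normr0 normr1.
move=> i u v w Pi [uvw u1 v1]; have ai := a1 i Pi; have bi := b1 i Pi.
split; last 2 first.
- by rewrite normrM mulr_ile1.
- by rewrite normrM mulr_ile1.
have -> : a i * u - b i * v = (a i - b i) * u + b i * (u - v) by ring.
apply: le_trans (ler_normD _ _) _; rewrite !normrM; apply: lerD.
  by rewrite ler_piMr.
by apply: le_trans uvw; rewrite ler_piMl.
Qed.

Definition matching_sum (R : comNzRingType) N (G : {set {set 'I_N}}) (S : {set 'I_N})
    (b : {set 'I_N} -> R) (d : 'I_N -> R) : R :=
  \sum_(M in matchings G S)
    (-1) ^+ #|M| * (\prod_(x in M) b x) * \prod_(j in S :\: cover M) d j.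

(** Each term is a product of numbers of modulus at most one, so its variation
    is at most the sum of the variations of its factors; and a matching is a set
    of edges, so there are at most 2^(number of edges) terms. *)
Lemma matching_sum_dist (R : realDomainType) N (G : {set {set 'I_N}}) S
    (b b' : {set 'I_N} -> R) (d d' : 'I_N -> R) (beta delta : R) :
    0 <= delta ->
    (forall x, x \in induced_edges G S -> `|b x| <= 1) ->
    (forall x, x \in induced_edges G S -> `|b' x| <= 1) ->
    (forall j, `|d j| <= 1) -> (forall j, `|d' j| <= 1) ->
    (forall x, x \in induced_edges G S -> `|b x - b' x| <= beta) ->
    (forall j, `|d j - d' j| <= delta) ->
  `|matching_sum G S b d - matching_sum G S b' d'|
     <= 2 ^+ #|induced_edges G S| * (#|induced_edges G S|%:R * beta + #|S|%:R * delta).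
Proof.
move=> delta_ge0 b1 b'1 d1 d'1 bb' dd'; set E := induced_edges G S.
have term M : M \in matchings G S ->
    `|(-1) ^+ #|M| * (\prod_(x in M) b x) * \prod_(j in S :\: cover M) d j
      - (-1) ^+ #|M| * (\prod_(x in M) b' x) * \prod_(j in S :\: cover M) d' j|
    <= #|E|%:R * beta + #|S|%:R * delta.
  rewrite inE => /andP[/subsetP sME _].
  have prodM1 (f : {set 'I_N} -> R) : (forall x, x \in E -> `|f x| <= 1) ->
      `|\prod_(x in M) f x| <= 1.
    by move=> f1; rewrite normr_prod; apply: prodr_ile1 => x Mx; rewrite normr_ge0 f1 ?sME.
  have prodD1 (f : 'I_N -> R) (A : {set 'I_N}) : (forall x, `|f x| <= 1) ->
      `|\prod_(x in A) f x| <= 1.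
    by move=> f1; rewrite normr_prod; apply: prodr_ile1 => x _; rewrite normr_ge0 f1.
  rewrite -!mulrA -mulrBr normrM normrX normrN1 expr1n mul1r.
  set p := \prod_(x in M) b x; set q := \prod_(j in _) d j.
  set p' := \prod_(x in M) b' x; set q' := \prod_(j in _) d' j.
  have -> : p * q - p' * q' = (p - p') * q + p' * (q - q') by ring.
  apply: le_trans (ler_normD _ _) _; rewrite !normrM; apply: lerD.
    apply: le_trans (ler_piMr _ (prodD1 _ _ d1)) _ => //.
    apply: le_trans (ler_dist_prod _ _) _ => [x Mx|x Mx|]; rewrite ?b1 ?b'1 ?sME //.
    rewrite mulr_natl -sumr_const [leRHS](bigID (mem M)) /=.
    apply: ler_wpDr; first by apply: sumr_ge0 => x /andP[/bb' le_b _]; apply: le_trans le_b.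
    rewrite [leRHS](eq_bigl (mem M)) => [|x]; last first.
      by apply/andP/idP => [[]//|Mx]; split=> //; apply: sME.
    by apply: ler_sum => x Mx; rewrite bb' ?sME.
  apply: le_trans (ler_piMl _ (prodM1 _ b'1)) _ => //.
  apply: le_trans (ler_dist_prod _ _) _ => [x _|x _|]; rewrite ?d1 ?d'1 //.
  apply: le_trans (_ : \sum_(j in S :\: cover M) delta <= _).
    by apply: ler_sum => j _; exact: dd'.
  rewrite sumr_const -[delta *+ _]mulr_natl; apply: ler_wpM2r => //.
  by rewrite ler_nat subset_leq_card // subsetDl.
rewrite /matching_sum -sumrB; apply: le_trans (ler_norm_sum _ _ _) _.
apply: le_trans (_ : \sum_(M in matchings G S) (#|E|%:R * beta + #|S|%:R * delta) <= _).
  exact: ler_sum.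
rewrite sumr_const -[leLHS]mulr_natl; apply: ler_wpM2r.
  have M0 : set0 \in matchings G S.
    by rewrite inE sub0set; apply/trivIsetP=> A B; rewrite inE.
  exact: le_trans (term _ M0).
rewrite -natrX ler_nat -card_powerset subset_leq_card //.
by apply/subsetP=> M; rewrite !inE => /andP[].
Qed.

Lemma card_sepset (T : finType) (C : {set T}) (p : pred T) :
  #|[set x in C | p x]| = (\sum_(x in C) p x)%N.
Proof.
rewrite -sum1_card (eq_bigl (fun x => (x \in C) && p x)) => [|x]; last by rewrite inE.
by rewrite big_mkcondr; apply: eq_bigr => x _; case: ifP.
Qed.

(** Pairing each factor with a sign -1 turns positive weights into negative ones
    and conversely, so the sign of the product counts the positive weights. This
    is what makes the equation of a cycle in the linear system independent of
    the parity of its length. *)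
Lemma alternating_prod_sign (R : realDomainType) (T : finType) (C : {set T}) (w : T -> R) :
    (forall x, x \in C -> w x != 0) ->
  (-1) ^+ #|C|.+1 * \prod_(x in C) w x
    = (-1) ^+ #|[set x in C | 0 < w x]|.+1 * \prod_(x in C) `|w x|.
Proof.
move=> w0; rewrite !exprS -!mulrA; congr (_ * _).
have -> : (-1) ^+ #|C| * \prod_(x in C) w x = \prod_(x in C) (- w x).
  by rewrite prodrN.
rewrite card_sepset expr_sum -big_split; apply: eq_bigr => x Cx /=.
case: ltP => [w_gt0|w_le0]; first by rewrite expr1 mulN1r gtr0_norm.
by rewrite expr0 mul1r ler0_norm.
Qed.

(** * Exact recovery from accurate moments *)

Lemma ler_dist_mul01 (R : realDomainType) (a b a' b' d : R) :
    0 <= b <= 1 -> 0 <= a' <= 1 -> `|a - a'| <= d -> `|b - b'| <= d ->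
  `|a * b - a' * b'| <= d + d.
Proof.
case/andP=> b0 b1 /andP[a0 a1] aa' bb'.
have -> : a * b - a' * b' = (a - a') * b + a' * (b - b') by ring.
apply: le_trans (ler_normD _ _) _; rewrite !normrM; apply: lerD.
  by apply: le_trans aa'; rewrite (ger0_norm b0) ler_piMr.
by apply: le_trans bb'; rewrite (ger0_norm a0) ler_piMl.
Qed.

Lemma sgz_of_close (R : realDomainType) (h t a : R) :
  `|h - 2 * t| < 2 * a -> a <= `|t| -> sgz h = sgz t.
Proof.
rewrite ltr_norml; case: (ltrgt0P t) => t0 /andP[lo hi] le_a; last first.
- by move: lo hi; rewrite t0 mulr0 subr0 => lo hi; exfalso; lra.
- by rewrite !ltr0_sgz //; lra.
by rewrite !gtr0_sgz //; lra.
Qed.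

Lemma F2_addE (a b c : 'F_2) :
  nat_of_ord (a + (b + c)) = ((a != 0) (+) ((b != 0) (+) (c != 0))) :> nat.
Proof.
by case: (F2_cases a) => ->; case: (F2_cases b) => ->; case: (F2_cases c) => ->.
Qed.

Section Recovery.
Variables (R : rcfType) (N n l : nat) (alpha delta tau : R) (K : 'M[R]_N).
Variable y : {ffun 'I_n -> {set 'I_N}}.

Lemma Delta_hat_ge0_le1 S : 0 <= Delta_hat R y S <= 1.
Proof.
have sum_ge0 : 0 <= \sum_(p < n) (S \subset y p)%:R :> R by apply: sumr_ge0 => p _; rewrite ler0n.
have sum_le : \sum_(p < n) (S \subset y p)%:R <= n%:R :> R.
  rewrite -natr_sum ler_nat -[leqRHS]card_ord -sum1_card; apply: leq_sum => p _.
  exact: leq_b1.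
rewrite /Delta_hat; set s := \sum_(p < n) _ in sum_ge0 sum_le *.
rewrite mulr_ge0 ?invr_ge0 ?ler0n //=.
have [n0|n_gt0] := posnP n; first by rewrite n0 invr0 mul0r ler01.
by rewrite mulrC ler_pdivrMr ?ltr0n // mul1r.
Qed.

Lemma Kdiag_hat_ge0_le1 i : 0 <= Kdiag_hat R y i <= 1.
Proof. exact: Delta_hat_ge0_le1. Qed.

Lemma B_hatC i j : B_hat R y i j = B_hat R y j i.
Proof. by rewrite /B_hat mulrC setUC. Qed.

Lemma B_hat_norm i j : `|B_hat R y i j| <= 1.
Proof.
have /andP[di0 di1] := Kdiag_hat_ge0_le1 i.
have /andP[dj0 dj1] := Kdiag_hat_ge0_le1 j.
have /andP[dij0 dij1] := Delta_hat_ge0_le1 [set i; j].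
have le1 : Kdiag_hat R y i * Kdiag_hat R y j <= 1 by rewrite mulr_ile1.
have ge0 : 0 <= Kdiag_hat R y i * Kdiag_hat R y j by rewrite mulr_ge0.
by rewrite /B_hat ler_norml; apply/andP; split; lra.
Qed.

Lemma mem_G_hat i j : i != j ->
  ([set i; j] \in G_hat alpha y) = (2^-1 * alpha ^+ 2 <= B_hat R y i j).
Proof.
move=> ij; apply/imset2P/idP => [[u v _]|Bij].
  rewrite inE => /andP[_ /andP[uv Buv]] /set2_eq[[-> ->] //|[-> ->]].
  by rewrite B_hatC.
by exists i j; rewrite ?inE // ij.
Qed.

Hypothesis alpha01 : 0 < alpha < 1.
Hypothesis symK : K^T = K.
Hypothesis gapK : forall i j : 'I_N, (i < j)%N -> K i j = 0 \/ alpha <= `|K i j|.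
Hypothesis det01 : forall S, 0 <= \det (principal K S) <= 1.
Hypothesis delta_ge0 : 0 <= delta.
Hypothesis small_dev : forall S : {set 'I_N}, S != set0 -> (#|S| <= 2)%N ->
  `|Delta_hat R y S - \det (principal K S)| <= delta.
Hypothesis delta_alpha : 3 * delta < 2^-1 * alpha ^+ 2.

Let symKij i j : K i j = K j i. Proof. by rewrite -{1}symK mxE. Qed.

Lemma gap_offdiag i j : i != j -> K i j = 0 \/ alpha <= `|K i j|.
Proof.
move=> ij; have [/gapK//|/gapK|/val_inj/eqP] := ltngtP i j; last by rewrite (negPf ij).
by rewrite symKij.
Qed.

Lemma diag01 i : 0 <= K i i <= 1.
Proof. by rewrite -det_principal1. Qed.

Lemma offdiag_sqr_le1 i j : i != j -> K i j ^+ 2 <= 1.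
Proof.
move=> ij; have := det01 [set i; j]; rewrite det_principal2 // => /andP[ge0 _].
have /andP[ki0 ki1] := diag01 i; have /andP[kj0 kj1] := diag01 j.
have le1 : K i i * K j j <= 1 by rewrite mulr_ile1.
by lra.
Qed.

Lemma Kdiag_hat_close i : `|Kdiag_hat R y i - K i i| <= delta.
Proof.
rewrite -det_principal1; apply: small_dev; last by rewrite cards1.
by apply/set0Pn; exists i; rewrite inE.
Qed.

Lemma B_hat_close i j : i != j -> `|B_hat R y i j - K i j ^+ 2| <= 3 * delta.
Proof.
move=> ij.
have dev_ij : `|Delta_hat R y [set i; j] - (K i i * K j j - K i j ^+ 2)| <= delta.
  rewrite -det_principal2 //; apply: small_dev; last by rewrite cards2 ij.
  by apply/set0Pn; exists i; rewrite set21.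
have prod_close : `|Kdiag_hat R y i * Kdiag_hat R y j - K i i * K j j| <= delta + delta.
  by apply: ler_dist_mul01; rewrite ?Kdiag_hat_close ?Kdiag_hat_ge0_le1 ?diag01.
move: prod_close dev_ij; rewrite /B_hat !ler_norml => /andP[a1 a2] /andP[b1 b2].
by apply/andP; split; lra.
Qed.

(** The threshold alpha^2 / 2 separates the value 0 of K_ij^2 from the values at
    least alpha^2 with a margin alpha^2 / 2 > 3 delta on both sides. *)
Lemma G_hat_eq : G_hat alpha y = graph_of K.
Proof.
have key i j : i != j -> ([set i; j] \in G_hat alpha y) = ([set i; j] \in graph_of K).
  move=> ij; rewrite mem_G_hat // mem_graph_of //.
  have := B_hat_close ij; rewrite ler_norml => /andP[lo hi].
  case: (gap_offdiag ij) => [Kij|gap].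
    rewrite Kij eqxx; apply/negbTE; rewrite -ltNge.
    move: hi; rewrite Kij expr2 mul0r subr0 => hi.
    exact: le_lt_trans hi delta_alpha.
  have alpha_gt0 : 0 < alpha by case/andP: alpha01.
  have -> : K i j != 0 by rewrite -normr_gt0; apply: lt_le_trans gap.
  have : alpha ^+ 2 <= K i j ^+ 2 by rewrite -[leRHS]real_normK ?num_real // lerXn2r ?nnegrE // ltW.
  move=> sqr_le; suff : 2^-1 * alpha ^+ 2 <= B_hat R y i j by [].
  by have := delta_alpha; lra.
apply/setP=> x; apply/idP/idP.
  by case/imset2P=> i j _; rewrite inE => /andP[_ /andP[ij Bij]] ->; rewrite -key // mem_G_hat.
by case/imset2P=> i j _; rewrite inE => /andP[_ /andP[ij Kij]] ->; rewrite key // mem_graph_of.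
Qed.

Hypothesis large_dev : forall S : {set 'I_N}, S != set0 -> (#|S| <= l)%N ->
  `|Delta_hat R y S - \det (principal K S)| <= tau.
Hypothesis delta_tau : delta <= tau.
Hypothesis tau_alpha : (1 + 4 * l%:R * 2 ^+ l) * tau < 2 * alpha ^+ l.

Let edge_ends x : x \in G_hat alpha y -> exists i j, i != j /\ x = [set i; j].
Proof. by rewrite G_hat_eq => /graph_of_pairs/eqP/cards2P. Qed.

Lemma edge_weight_ge x : x \in G_hat alpha y -> alpha <= `|edge_weight K x|.
Proof.
move=> Gx; have [i [j [ij def_x]]] := edge_ends Gx.
move: Gx; rewrite G_hat_eq def_x mem_graph_of // edge_weightE //.
by case: (gap_offdiag ij) => [->|//]; rewrite eqxx.
Qed.

Let cycle_term (C : {set {set 'I_N}}) : R :=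
  2 * ((-1) ^+ #|C|.+1 * \prod_(x in C) edge_weight K x).

(** Both H_hat and the cycle term are a moment minus a sum over matchings, by
    [det_induced_cycle]. The moment varies by tau, and the sum by at most
    2^|C| (3 |C| delta + |C| delta). *)
Lemma H_hat_close C : induced_cycle (G_hat alpha y) C -> C != set0 -> (#|C| <= l)%N ->
  `|H_hat alpha y (cover C) - cycle_term C| < 2 * alpha ^+ #|C|.
Proof.
move=> indC C0 Cl; have tau_ge0 : 0 <= tau by exact: le_trans delta_tau.
have alpha_gt0 : 0 < alpha by case/andP: alpha01.
have G_pairs : forall x, x \in G_hat alpha y -> #|x| = 2%N.
  by rewrite G_hat_eq; exact: graph_of_pairs.
have cycC : simple_cycle (G_hat alpha y) C by case/andP: indC.
have CE : induced_edges (G_hat alpha y) (cover C) = C by apply/esym/eqP; case/andP: indC.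
have cardC := card_simple_cycle G_pairs cycC C0.
have detC := det_induced_cycle symK; rewrite -G_hat_eq in detC.
have {}detC := detC C indC C0.
have S0 : cover C != set0 by rewrite -card_gt0 -cardC card_gt0.
have dev : `|Delta_hat R y (cover C) - \det (principal K (cover C))| <= tau.
  by apply: large_dev; rewrite // -cardC.
pose bh := edge_weight (B_hat R y); pose b := edge_weight (fun j k => K j k ^+ 2).
have bhE i j : i != j -> bh [set i; j] = B_hat R y i j by apply: edge_weightE; exact: B_hatC.
have bE i j : i != j -> b [set i; j] = K i j ^+ 2.
  by apply: (edge_weightE (F := fun j k => K j k ^+ 2)) => u v; rewrite symKij.
have HE : H_hat alpha y (cover C)
    = Delta_hat R y (cover C) - matching_sum (G_hat alpha y) (cover C) bh (Kdiag_hat R y).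
  by rewrite /H_hat; congr (_ - _); apply: eq_bigr => M _; rewrite edge_prodE.
have DE : \det (principal K (cover C))
    = matching_sum (G_hat alpha y) (cover C) b (fun j => K j j) + cycle_term C.
  by rewrite detC; congr (_ + _); apply: eq_bigr => M _; rewrite edge_prodE.
have dist := @matching_sum_dist R N (G_hat alpha y) (cover C) bh b (Kdiag_hat R y)
  (fun j => K j j) (3 * delta) delta delta_ge0.
rewrite CE -cardC in dist.
have {dist} : `|matching_sum (G_hat alpha y) (cover C) bh (Kdiag_hat R y)
    - matching_sum (G_hat alpha y) (cover C) b (fun j => K j j)|
    <= 2 ^+ #|C| * (#|C|%:R * (3 * delta) + #|C|%:R * delta).
  have sCG x : x \in C -> x \in G_hat alpha y by rewrite -{1}CE inE => /andP[].
  apply: dist.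
  - by move=> x /sCG/edge_ends[i [j [ij ->]]]; rewrite bhE // B_hat_norm.
  - move=> x /sCG/edge_ends[i [j [ij ->]]]; rewrite bE //.
    by rewrite ger0_norm ?sqr_ge0 // offdiag_sqr_le1.
  - by move=> j; have /andP[d0 d1] := Kdiag_hat_ge0_le1 j; rewrite (ger0_norm d0).
  - by move=> j; have /andP[d0 d1] := diag01 j; rewrite ger0_norm.
  - by move=> x /sCG/edge_ends[i [j [ij ->]]]; rewrite bhE // bE // B_hat_close.
  - exact: Kdiag_hat_close.
have -> : 2 ^+ #|C| * (#|C|%:R * (3 * delta) + #|C|%:R * delta)
    = 4 * #|C|%:R * 2 ^+ #|C| * delta :> R.
  by move: (2 ^+ #|C|) (#|C|%:R) => p c; ring.
have le_l : 4 * #|C|%:R * 2 ^+ #|C| * delta <= 4 * l%:R * 2 ^+ l * tau.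
  rewrite ler_pM ?mulr_ge0 ?exprn_ge0 ?ler0n // ler_pM ?mulr_ge0 ?exprn_ge0 ?ler0n //.
    by rewrite ler_wpM2l ?ler0n // ler_nat.
  by rewrite ler_weXn2l ?ler1n.
have alpha_le : alpha ^+ l <= alpha ^+ #|C|.
  by rewrite ler_wiXn2l // ltW //; case/andP: alpha01.
have := tau_alpha; rewrite mulrDl mul1r.
rewrite HE; move: dev le_l alpha_le; rewrite DE.
move: (cycle_term C) (matching_sum _ _ bh _) (matching_sum _ _ b _) (Delta_hat _ _ _).
move: (4 * _ * _ * _) (4 * _ * _ * _) (alpha ^+ l) (alpha ^+ _).
move=> err err' al aC t m m' D dev le_err le_a lt_err dist.
have -> : D - m - t = (D - (m' + t)) - (m - m') by ring.
apply: le_lt_trans (ler_normB _ _) _; apply: le_lt_trans (lerD dev dist) _.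
apply: le_lt_trans (lerD (lexx tau) le_err) _; apply: lt_le_trans lt_err _.
by rewrite ler_pM2l // ltr0n.
Qed.

(** The cycle term has modulus at least 2 alpha^|C|, beyond the error of
    [H_hat_close]. In particular H_hat is nonzero. *)
Lemma H_hat_sign C : induced_cycle (G_hat alpha y) C -> C != set0 -> (#|C| <= l)%N ->
  sgz (H_hat alpha y (cover C)) = (-1) ^+ #|[set x in C | 0 < edge_weight K x]|.+1.
Proof.
move=> indC C0 Cl; have := H_hat_close indC C0 Cl.
have alpha_gt0 : 0 < alpha by case/andP: alpha01.
have sCG x : x \in C -> x \in G_hat alpha y.
  by case/andP: indC => /andP[/and3P[/subsetP sCG _ _] _] _ /sCG.
have prod_ge : alpha ^+ #|C| <= \prod_(x in C) `|edge_weight K x|.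
  rewrite -prodr_const; apply: ler_prod => x Cx; rewrite ltW //=.
  by apply: edge_weight_ge; apply: sCG.
rewrite /cycle_term alternating_prod_sign; last first.
  by move=> x /sCG/edge_weight_ge; rewrite -normr_gt0; exact: lt_le_trans.
set sg := (-1) ^+ _; set p := \prod_(x in C) _ in prod_ge *.
move=> dev; have p_gt0 : 0 < p by apply: lt_le_trans prod_ge; rewrite exprn_gt0.
rewrite (sgz_of_close dev); last by rewrite normrM normrX normrN1 expr1n mul1r gtr0_norm.
by rewrite sgzM sgzX sgzN1 (gtr0_sgz p_gt0) mulr1.
Qed.

Hypothesis sparsityG : is_cycle_sparsity (graph_of K) l.

Lemma shortest_basis_cycles Cs C : shortest_maximal_cycle_basis (G_hat alpha y) Cs ->
  C \in Cs -> [/\ induced_cycle (G_hat alpha y) C, C != set0 & (#|C| <= l)%N].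
Proof.
have sparsG := sparsityG; rewrite -G_hat_eq in sparsG.
case=> l' sparsG' /and3P[/andP[basCs _] /allP indCs /allP lenCs] CsC.
have free_Cs := basis_free basCs.
have C0 : C != set0.
  apply: contraTneq free_Cs => C0; apply/negP=> free_Cs.
  have /negP[] := free_not0 free_Cs (map_f (incidence (G_hat alpha y)) CsC).
  by apply/eqP/rowP=> r; rewrite C0 !mxE inE.
split; [exact: indCs | by [] | apply: leq_trans (lenCs _ CsC) _].
move: sparsG sparsG'; rewrite /is_cycle_sparsity; case: ifP => _; first by move=> -> ->.
by case=> -[Ds basDs] _ [_ min_l']; apply: min_l' basDs.
Qed.

Definition positive_edges : 'cV['F_2]_#|G_hat alpha y| :=
  \col_(r < #|G_hat alpha y|) (0 < edge_weight K (enum_val r))%R%:R.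

Lemma incidence_mul (G C : {set {set 'I_N}}) (f : {set 'I_N} -> 'F_2) : C \subset G ->
  \sum_(r < #|G|) incidence G C 0 r * f (enum_val r) = \sum_(x in C) f x.
Proof.
move=> /subsetP sCG.
rewrite (eq_bigr (fun r => (enum_val r \in C)%:R * f (enum_val r))) => [|r _]; last first.
  by rewrite mxE.
rewrite -(big_enum_val (fun x => (x \in C)%:R * f x)).
rewrite [RHS](eq_bigl (fun x => (x \in G) && (x \in C))) => [|x]; last first.
  by apply/idP/andP => [Cx|[]//]; rewrite Cx (sCG _ Cx).
rewrite [RHS]big_mkcondr; apply: eq_bigr => x _.
by case: (x \in C); rewrite ?mul1r ?mul0r.
Qed.

(** By [H_hat_sign] the sign of H_hat is positive exactly when the number of
    positive edges of the cycle is odd. *)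
Lemma positive_edges_solution s0 Cs : shortest_maximal_cycle_basis (G_hat alpha y) Cs ->
  cycle_matrix alpha y Cs *m positive_edges = cycle_signs alpha s0 y Cs.
Proof.
move=> basCs; apply/colP=> i; rewrite !mxE.
set C := nth set0 Cs i.
have [indC C0 Cl] : [/\ induced_cycle (G_hat alpha y) C, C != set0 & (#|C| <= l)%N].
  by apply: shortest_basis_cycles basCs _; apply: mem_nth.
have sgH := H_hat_sign indC C0 Cl.
have sCG : C \subset G_hat alpha y by case/andP: indC => /andP[/and3P[]].
rewrite (eq_bigr (fun r => incidence (G_hat alpha y) C 0 r
                           * (0 < edge_weight K (enum_val r))%R%:R)); last first.
  by move=> r _; rewrite !mxE.
rewrite (incidence_mul (fun x => (0 < edge_weight K x)%R%:R) sCG) -natr_sum.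
rewrite -(card_sepset C (fun x => (0 < edge_weight K x)%R)).
move: sgH; set m := #|[set x in C | _]|; rewrite -signr_odd /= => sgH.
have H0 : H_hat alpha y (cover C) != 0 by rewrite -sgz_eq0 sgH signr_eq0.
rewrite /sgn_conv (negPf H0) sgH; have := natrF2_eq0 m.
by case: (F2_cases m%:R) => ->; rewrite ?eqxx ?oner_eq0; case: (odd m) => //= _; apply: val_inj.
Qed.

(** The difference of two solutions is orthogonal to the cycle basis, so it is
    the coboundary of some u. *)
Lemma estimate_sign s0 Cs (x : 'cV['F_2]_#|G_hat alpha y|) :
    shortest_maximal_cycle_basis (G_hat alpha y) Cs ->
    solution_or_ones (cycle_matrix alpha y Cs) (cycle_signs alpha s0 y Cs) x ->
  exists u : 'I_N -> 'F_2, forall i j, i != j -> [set i; j] \in G_hat alpha y ->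
    edge_coord x [set i; j] = (0 < K i j)%R%:R + (u i + u j).
Proof.
move=> basCs; have sol := positive_edges_solution s0 basCs.
have G_pairs : forall x, x \in G_hat alpha y -> #|x| = 2%N.
  by rewrite G_hat_eq; exact: graph_of_pairs.
rewrite /solution_or_ones ifT => [/eqP sol_x|]; last first.
  by apply/existsP; exists positive_edges; rewrite sol.
pose z := (x - positive_edges)^T.
have zCs C : C \in Cs -> z *m (incidence (G_hat alpha y) C)^T = 0.
  move=> CsC; have [i lt_i def_C] := nthP set0 CsC.
  have : cycle_matrix alpha y Cs *m (x - positive_edges) = 0 by rewrite mulmxBr sol_x sol subrr.
  move/(congr1 (row (Ordinal lt_i))); rewrite row_mul rowK /= def_C row0 => zC.
  by rewrite -trmx_mul zC trmx0.
have basis_Cs : cycle_basis (G_hat alpha y) Cs by case: basCs => l' _ /and3P[].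
have [u uP] := orthogonal_cycles_coboundary G_pairs (cycle_space_orthogonal basis_Cs zCs).
exists u => i j ij Gij; have [r def_r] : exists r : 'I_#|G_hat alpha y|, enum_val r = [set i; j].
  by exists (enum_rank_in Gij [set i; j]); rewrite enum_rankK_in.
rewrite /edge_coord (big_pred1 r) => [|r']; last first.
  by rewrite -def_r (inj_eq enum_val_inj).
by have := uP r i j def_r ij; rewrite !mxE def_r edge_weightE // => <-; rewrite addrCA subrr addr0.
Qed.

Lemma sqrt_B_hat_close i j eps : [set i; j] \in G_hat alpha y -> i != j ->
  3 * delta <= alpha * eps -> `|Num.sqrt (B_hat R y i j) - `|K i j| | <= eps.
Proof.
move=> Gij ij delta_eps; have alpha_gt0 : 0 < alpha by case/andP: alpha01.
have gap : alpha <= `|K i j| by rewrite -(edge_weightE symKij ij) edge_weight_ge.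
have B_ge0 : 0 <= B_hat R y i j.
  move: Gij; rewrite mem_G_hat //; apply: le_trans.
  by rewrite mulr_ge0 ?invr_ge0 ?ler0n // exprn_ge0 // ltW.
have close := le_trans (B_hat_close ij) delta_eps.
set s := Num.sqrt _; set k := `|K i j| in gap *.
have s_ge0 : 0 <= s := sqrtr_ge0 _.
have factor : `|s - k| * (s + k) = `|B_hat R y i j - K i j ^+ 2|.
  have sk_ge0 : 0 <= s + k by rewrite addr_ge0 // /k.
  rewrite -{1}(ger0_norm sk_ge0) -normrM -(sqr_sqrtr B_ge0) -[K i j ^+ 2]real_normK ?num_real //.
  by rewrite -/s -/k subr_sqr.
rewrite -(ler_pM2l alpha_gt0); apply: le_trans close; rewrite -factor mulrC ler_wpM2l //.
by rewrite ler_wpDl.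
Qed.

(** Conjugation by the signs (-1)^(u i) undoes the coboundary left free by
    [estimate_sign]. *)
Theorem estimate_recovers s0 eps Khat :
    delta <= eps -> 3 * delta <= alpha * eps -> moment_estimate alpha s0 y Khat ->
  exists D : 'M[R]_N, sign_diag D /\ forall i j, `|(D *m Khat *m D - K) i j| <= eps.
Proof.
move=> delta_le delta_eps [Cs [x [basCs solx ->]]].
have [u uP] := estimate_sign basCs solx.
pose s i : R := (-1) ^+ (u i != 0); pose D := diag_mx (\row_i s i).
have ss i : s i * s i = 1 by rewrite /s -expr2 sqrr_sign.
exists D; split.
  apply/andP; split; first exact: diag_mx_is_diag.
  by apply/forallP=> i; rewrite !mxE eqxx mulr1n /s; case: (u i != 0); rewrite ?eqxx ?orbT.
move=> i j; rewrite /D mul_mx_diag mul_diag_mx !mxE.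
have eps_ge0 := le_trans delta_ge0 delta_le.
have [<-|ij] := eqVneq i j.
  by rewrite mulrAC ss mul1r; apply: le_trans (Kdiag_hat_close i) delta_le.
have [Gij|] := boolP ([set i; j] \in G_hat alpha y); last first.
  by rewrite G_hat_eq mem_graph_of // negbK => /eqP->; rewrite mulr0 mul0r subrr normr0.
rewrite uP //.
have K0 : K i j != 0 by rewrite -mem_graph_of // -G_hat_eq.
have defK : K i j = (-1) ^+ (K i j < 0)%R * `|K i j| by rewrite -realEsign ?num_real.
have -> : s i * (((2 * (nat_of_ord ((0 < K i j)%R%:R + (u i + u j)))%:R - 1)
                  * Num.sqrt (B_hat R y i j))) * s j
   = (-1) ^+ (K i j < 0)%R * Num.sqrt (B_hat R y i j).
  have neg_K : (K i j < 0) = ~~ (0 < K i j) by rewrite -leNgt lt_neqAle K0.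
  rewrite F2_addE neg_K; set q := Num.sqrt _; rewrite /s.
  have -> : ((0 < K i j)%R%:R != 0 :> 'F_2) = (0 < K i j).
    by case: (0 < K i j); rewrite ?eqxx ?oner_eq0.
  by case: (u i != 0); case: (u j != 0); case: (0 < K i j) => /=; ring.
rewrite [X in _ - X]defK -mulrBr normrM normr_sign mul1r; exact: sqrt_B_hat_close.
Qed.

End Recovery.

(** * Counting vertex sets *)

(** A nonempty set with at most k elements is the image of a function on k
    points. *)
Lemma card_small_subsets N k :
  (#|[set S : {set 'I_N} | (S != set0) && (#|S| <= k)%N]| <= N ^ k)%N.
Proof.
rewrite -[in leqRHS](card_ord N) -[in leqRHS](card_ord k) -card_ffun.
apply: leq_trans (leq_imset_card (fun f : {ffun 'I_k -> 'I_N} => f @: [set: 'I_k]) predT).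
apply/subset_leq_card/subsetP=> S; rewrite inE => /andP[/set0Pn[v Sv] le_k].
apply/imsetP; exists [ffun i : 'I_k => nth v (enum S) i]; first by [].
apply/setP=> w; apply/idP/imsetP => [Sw|[i _ ->]]; last first.
  rewrite ffunE; have [lt_i|ge_i] := ltnP i #|S|; last by rewrite nth_default // -cardE.
  by rewrite -mem_enum mem_nth // -cardE.
have lt_w : (index w (enum S) < k)%N.
  by apply: leq_trans le_k; rewrite cardE index_mem mem_enum.
by exists (Ordinal lt_w); rewrite ?inE // ffunE /= nth_index // mem_enum.
Qed.

Lemma ler_sum_union (R : numDomainType) (I J : finType) (Q : pred J) (bad : J -> pred I)
    (m : I -> R) : (forall i, 0 <= m i) ->
  \sum_(i | [exists j, Q j && bad j i]) m i <= \sum_(j | Q j) \sum_(i | bad j i) m i.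
Proof.
move=> m_ge0.
rewrite [leRHS](eq_bigr (fun j => \sum_i if bad j i then m i else 0)) => [|j _]; last exact: big_mkcond.
rewrite exchange_big big_mkcond; apply: ler_sum => i _ /=.
have term_ge0 j : 0 <= (if bad j i then m i else 0) by case: ifP.
case: ifP => [/existsP[j /andP[Qj badj]]|_]; last by apply: sumr_ge0.
by rewrite (bigD1 j) //= badj lerDl sumr_ge0.
Qed.

(** A nontrivial cycle space has a nonempty basis, and a simple cycle has at
    least three edges. *)
Lemma cycle_sparsity_ge2 (R : realDomainType) N (K : 'M[R]_N) l :
  is_cycle_sparsity (graph_of K) l -> (2 <= l)%N.
Proof.
rewrite /is_cycle_sparsity; case: eqP => [_ ->//|nz [[[|C Cs] basCs] _]].
  by case: nz; case/and3P: basCs => /andP[/andP[/eqP <- _] _] _ _; rewrite span_nil.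
case/and3P: basCs => /andP[/basis_free/free_not0 freeCs /andP[cycC _]] _ /andP[le_l _].
apply: leq_trans le_l; apply/ltnW/(simple_cycle_gt2 (@graph_of_pairs R N K) cycC).
have inc0 : incidence (graph_of K) C != 0 by apply: freeCs; exact: mem_head.
by apply: contraNneq inc0 => ->; apply/eqP/rowP=> r; rewrite !mxE inE.
Qed.

(** * Laws of finite random variables *)

From mathcomp Require Import all_classical all_reals all_analysis.
Import numFieldNormedType.Exports.
Local Open Scope classical_set_scope.
Local Open Scope ring_scope.

Section FiniteLaws.
Context (R : realType) (d : measure_display) (T : measurableType d).
Variables (P : probability T R) (F : finType) (X : T -> F).
Hypothesis X_measurable : forall f, measurable [set t | X t = f].

Definition point_mass (f : F) : R := fine (P [set t | X t = f]).

Lemma point_massE f : P [set t | X t = f] = (point_mass f)%:E.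
Proof. by rewrite /point_mass fineK // fin_num_measure. Qed.

Lemma point_mass_ge0 f : 0 <= point_mass f.
Proof. by rewrite -lee_fin -point_massE. Qed.

Lemma prob_finite_law (E : pred F) :
  P [set t | E (X t)] = (\sum_(f | E f) point_mass f)%:E.
Proof.
have law_seq (s : seq F) : uniq s ->
    measurable [set t | X t \in s] /\
    P [set t | X t \in s] = (\sum_(f <- s) point_mass f)%:E.
  elim: s => [_|f s IHs /= /andP[fs /IHs[mes_s Ps]]].
    rewrite big_nil (_ : [set t | _] = set0) ?measure0; first by [].
    by apply/seteqP; split=> t.
  have -> : [set t | X t \in f :: s] = [set t | X t = f] `|` [set t | X t \in s].
    apply/seteqP; split=> t /=; rewrite inE.
      by case/orP=> [/eqP|]; [left | right].
    by case=> [->|->]; rewrite ?eqxx ?orbT.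
  split; first exact: measurableU.
  rewrite measureU //; last first.
    by apply/seteqP; split=> t //= -[->]; rewrite (negPf fs).
  by rewrite big_cons EFinD -Ps -point_massE.
rewrite -big_filter.
have [_ <-] := law_seq [seq f <- index_enum F | E f] (filter_uniq _ (index_enum_uniq _)).
congr (P _); apply/seteqP; split=> t /=; rewrite mem_filter mem_index_enum andbT //.
Qed.

Lemma sum_point_mass : \sum_f point_mass f = 1.
Proof.
have := prob_finite_law predT; rewrite (_ : [set t | _] = setT) ?probability_setT.
  by case=> <-.
by apply/seteqP; split.
Qed.

End FiniteLaws.

(** From 1 - x/2 <= exp(-x/2) one gets exp x <= (1 - x/2)^-2, and
    (1 + x + x^2) (1 - x/2)^2 - 1 = (x/2)^2 (1 - 3 x + x^2) is nonnegative for
    x <= 1/4. *)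
Lemma expR_le_quadratic (R : realType) (x : R) : `|x| <= 4^-1 -> expR x <= 1 + x + x ^+ 2.
Proof.
rewrite ler_norml => /andP[lo hi].
have half_gt0 : 0 < 1 - x / 2 by lra.
have le_half : expR (x / 2) <= (1 - x / 2)^-1.
  rewrite -[expR _]invrK lef_pV2 ?posrE ?invr_gt0 ?expR_gt0 // -expRN.
  by have := expR_ge1Dx (- (x / 2)).
have -> : expR x = expR (x / 2) ^+ 2 by rewrite expr2 -expRD; congr expR; field.
apply: le_trans (_ : (1 - x / 2)^-1 ^+ 2 <= _).
  by rewrite lerXn2r ?nnegrE ?expR_ge0 // invr_ge0 ltW.
rewrite -[leLHS]mul1r exprVn ler_pdivrMr ?exprn_gt0 //.
have -> : (1 + x + x ^+ 2) * (1 - x / 2) ^+ 2 = 1 + (x / 2) ^+ 2 * (1 - 3 * x + x ^+ 2) by field.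
by rewrite lerDl mulr_ge0 ?sqr_ge0 //; have := sqr_ge0 x; lra.
Qed.

(** * Concentration of empirical moments *)

Section Chernoff.
Variables (R : realType) (F : finType) (n : nat) (q : 'I_n -> F -> R).
Hypothesis q_ge0 : forall p f, 0 <= q p f.
Hypothesis q_sum1 : forall p, \sum_f q p f = 1.

Definition product_mass (w : {ffun 'I_n -> F}) : R := \prod_p q p (w p).

Lemma product_mass_ge0 w : 0 <= product_mass w.
Proof. exact: prodr_ge0. Qed.

Lemma sum_product_mass : \sum_w product_mass w = 1.
Proof.
rewrite -(bigA_distr_bigA q) big1 // => p _; exact: q_sum1.
Qed.

(** Exponential Markov inequality with parameter lam = delta / 2, the optimal one
    for the bound exp(lam^2) on the exponential moments. Since delta is at most
    1/2, the arguments lam g stay in the range of [expR_le_quadratic]. *)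
Lemma product_mass_tail (g : F -> R) (delta : R) :
    0 <= delta <= 2^-1 -> (forall f, `|g f| <= 1) ->
    (forall p, \sum_f q p f * g f = 0) ->
  \sum_(w : {ffun 'I_n -> F} | n%:R * delta <= \sum_p g (w p)) product_mass w
    <= expR (- (n%:R * delta ^+ 2 / 4)).
Proof.
case/andP=> delta_ge0 delta_le g1 mean0; pose lam := delta / 2.
have lam_ge0 : 0 <= lam by rewrite divr_ge0.
pose h p f := q p f * expR (lam * g f).
have step : \sum_(w : {ffun 'I_n -> F} | n%:R * delta <= \sum_p g (w p)) product_mass w
    <= expR (- (lam * (n%:R * delta))) * \sum_(w : {ffun 'I_n -> F}) \prod_p h p (w p).
  rewrite mulr_sumr big_mkcond; apply: ler_sum => w _.
  have -> : \prod_p h p (w p) = product_mass w * expR (lam * \sum_p g (w p)).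
    by rewrite big_split /= mulr_sumr expR_sum.
  rewrite mulrCA -expRD; case: ifP => [le_w|_]; last first.
    by rewrite mulr_ge0 ?product_mass_ge0 ?expR_ge0.
  rewrite ler_peMr ?product_mass_ge0 // -[leLHS]expR0 ler_expR.
  by rewrite addrC subr_ge0 ler_wpM2l.
apply: le_trans step _; rewrite -(bigA_distr_bigA h).
have le_h p : \sum_f h p f <= expR (lam ^+ 2).
  apply: le_trans (_ : \sum_f q p f * (1 + lam * g f + lam ^+ 2) <= _).
    apply: ler_sum => f _; rewrite ler_wpM2l //.
    have lg : `|lam * g f| <= 4^-1.
      rewrite normrM (ger0_norm lam_ge0); apply: le_trans (ler_piMr lam_ge0 (g1 f)) _.
      by rewrite /lam; lra.
    apply: le_trans (expR_le_quadratic lg) _; rewrite lerD2l exprMn ler_piMr ?sqr_ge0 //.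
    by rewrite -[g f ^+ 2]real_normK ?num_real // expr_le1.
  under eq_bigr => f _ do rewrite 2!mulrDr mulr1 mulrCA.
  rewrite !big_split /= -mulr_sumr mean0 mulr0 addr0 -mulr_suml q_sum1 mul1r.
  exact: expR_ge1Dx.
apply: le_trans (_ : expR (- (lam * (n%:R * delta))) * expR (lam ^+ 2) ^+ n <= _).
  rewrite ler_wpM2l ?expR_ge0 // -[n in _ ^+ n]card_ord -prodr_const.
  by apply: ler_prod => p _; rewrite le_h andbT sumr_ge0 // => f _; rewrite mulr_ge0 ?expR_ge0.
rewrite -expRM_natl -expRD ler_expR.
by rewrite (_ : _ + _ = - (n%:R * delta ^+ 2 / 4)) // /lam; field.
Qed.

End Chernoff.

Section EmpiricalMoments.
Variables (R : realType) (N n : nat) (q : 'I_n -> {set 'I_N} -> R) (D : {set 'I_N} -> R).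
Hypothesis q_ge0 : forall p s, 0 <= q p s.
Hypothesis q_sum1 : forall p, \sum_s q p s = 1.
Hypothesis q_mean : forall p (S : {set 'I_N}), \sum_(s : {set 'I_N} | S \subset s) q p s = D S.
Hypothesis D01 : forall S, 0 <= D S <= 1.
Hypothesis n_gt0 : (0 < n)%N.

Lemma Delta_hat_deviation (S : {set 'I_N}) (delta : R) : 0 <= delta <= 2^-1 ->
  \sum_(w : {ffun 'I_n -> {set 'I_N}} | delta < `|Delta_hat R w S - D S|) product_mass q w
    <= 2 * expR (- (n%:R * delta ^+ 2 / 4)).
Proof.
move=> delta01; have nR_gt0 : 0 < n%:R :> R by rewrite ltr0n.
pose g (s : {set 'I_N}) : R := (S \subset s)%:R - D S.
have g1 s : `|g s| <= 1.
  have /andP[D0 D1] := D01 S; rewrite /g ler_norml.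
  by case: (S \subset s) => /=; apply/andP; split; lra.
have g_mean p : \sum_s q p s * g s = 0.
  under eq_bigr => s _ do rewrite mulrBr.
  rewrite sumrB -mulr_suml q_sum1 mul1r -(q_mean p S) [X in _ - X]big_mkcond /=.
  apply/eqP; rewrite subr_eq0; apply/eqP; apply: eq_bigr => s _.
  by case: ifP; rewrite ?mulr1 ?mulr0.
have gE (w : {ffun 'I_n -> {set 'I_N}}) : \sum_p g (w p) = n%:R * (Delta_hat R w S - D S).
  rewrite sumrB sumr_const card_ord mulrBr /Delta_hat mulrA mulfV ?lt0r_neq0 // mul1r.
  by rewrite mulr_natl.
have upper := product_mass_tail q_ge0 q_sum1 delta01 g1 g_mean.
have lower : \sum_(w : {ffun 'I_n -> {set 'I_N}} | n%:R * delta <= \sum_p - g (w p)) product_mass q w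
    <= expR (- (n%:R * delta ^+ 2 / 4)).
  apply: (product_mass_tail q_ge0 q_sum1 delta01 (g := fun s => - g s)).
    by move=> s; rewrite normrN.
  by move=> p; under eq_bigr => s _ do rewrite mulrN; rewrite sumrN g_mean oppr0.
rewrite mulr_natl mulr2n; apply: le_trans (lerD upper lower).
rewrite [leLHS]big_mkcond [X in _ <= X + _]big_mkcond [X in _ <= _ + X]big_mkcond -big_split /=.
apply: ler_sum => w _; rewrite sumrN gE -mulrN !ler_pM2l //.
have m_ge0 := product_mass_ge0 q_ge0 w.
have [dev|_] := ltP; last by rewrite addr_ge0 //; case: ifP.
have [D_ge|D_lt] := leP (D S) (Delta_hat R w S).
  rewrite ger0_norm ?subr_ge0 // in dev.
  by rewrite (ltW dev) lerDl; case: ifP.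
rewrite ltr0_norm ?subr_lt0 // in dev.
by rewrite (ltW dev) lerDr; case: ifP.
Qed.

(** The bound on the size enters only through the number N^k of the sets. *)
Lemma uniform_deviation (k : nat) (delta : R) : 0 <= delta <= 2^-1 ->
  \sum_(w : {ffun 'I_n -> {set 'I_N}} |
      [exists S : {set 'I_N}, ((S != finset.set0) && (#|S| <= k)%N)
                              && (delta < `|Delta_hat R w S - D S|)])
     product_mass q w
    <= N%:R ^+ k * (2 * expR (- (n%:R * delta ^+ 2 / 4))).
Proof.
move=> delta01; apply: le_trans (ler_sum_union _ _ (product_mass_ge0 q_ge0)) _.
apply: le_trans (ler_sum _ (fun S _ => Delta_hat_deviation S delta01)) _.
rewrite sumr_const -[leLHS]mulr_natl ler_wpM2r ?mulr_ge0 ?expR_ge0 //.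
rewrite -natrX ler_nat; apply: leq_trans (card_small_subsets N k).
by apply/subset_leq_card/fintype.subsetP=> S; rewrite finset.inE.
Qed.

End EmpiricalMoments.

Lemma rho_le (R : realType) N (K K' D : 'M[R]_N) (eps : R) : 0 <= eps ->
    sign_diag D -> (forall i j, `|(D *m K *m D - K') i j| <= eps) -> rho K K' <= eps.
Proof.
move=> eps_ge0 signD close; rewrite /rho.
apply: le_trans (_ : mx_norm (D *m K *m D - K') <= _).
  apply: ge_inf; last by exists D.
  by exists 0 => _ [D' _ <-]; rewrite /mx_norm.
by rewrite mx_normrE; apply: bigmax_le => // -[i j] _; exact: close.
Qed.

(** Here N^k = exp(k ln N), and the factor 2 is absorbed by N. *)
Lemma union_tail_le (R : realType) (N k : nat) (B x : R) : (1 < N)%N ->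
    (k%:R + B + 1) * ln N%:R <= x ->
  N%:R ^+ k * (2 * expR (- x)) <= expR (- (B * ln N%:R)).
Proof.
move=> N_gt1 le_x; have N_gt0 : 0 < N%:R :> R by rewrite ltr0n ltnW.
have two_le : 2 <= expR (ln N%:R) :> R by rewrite lnK ?posrE // ler_nat.
have -> : N%:R ^+ k = expR (k%:R * ln N%:R) :> R by rewrite expRM_natl lnK.
apply: le_trans (_ : expR (k%:R * ln N%:R) * (expR (ln N%:R) * expR (- x)) <= _).
  by rewrite ler_wpM2l ?expR_ge0 // ler_wpM2r ?expR_ge0.
by rewrite -!expRD ler_expR; lra.
Qed.

(** * The law of the sample *)

Section Sample.
Context (R : realType) (d : measure_display) (T : measurableType d).
Variables (P : probability T R) (N n : nat) (K : 'M[R]_N) (Y : 'I_n -> T -> {set 'I_N}).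
Hypothesis iidY : iid_DPP P K Y.

Let q p s : R := point_mass P (Y p) s.
Let sample t : {ffun 'I_n -> {set 'I_N}} := [ffun p => Y p t].

Lemma sample_measurable w : measurable [set t | sample t = w].
Proof.
have -> : [set t | sample t = w] = \bigcap_(p in [set: 'I_n]) [set t | Y p t = w p].
  apply/seteqP; split=> t /=; first by move=> <- p _; rewrite /= ffunE.
  by move=> Yw; apply/ffunP=> p; rewrite ffunE; exact: Yw.
by apply: fin_bigcap_measurable => // p _; case: iidY => mesY _ _; exact: mesY.
Qed.

Lemma sample_point_mass w : point_mass P sample w = product_mass q w.
Proof.
case: iidY => mesY indY _; apply: EFin_inj; rewrite -point_massE; last exact: sample_measurable.
have := indY (fun p => finset.set1 (w p)).
rewrite (_ : [set t | _] = [set t | sample t = w]); last first.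
  apply/seteqP; split=> t /=.
    move=> Yw; apply/ffunP=> p; rewrite ffunE; exact/finset.set1P/Yw.
  by move=> <- p; rewrite ffunE; exact/finset.set1P.
move=> ->; rewrite /product_mass -prodEFin; apply: eq_bigr => p _.
rewrite -(point_massE P (mesY p)); congr (P _); apply/seteqP; split=> t /=.
  by move/finset.set1P.
by move=> Yw; exact/finset.set1P.
Qed.

Lemma sample_mean p (S : {set 'I_N}) :
  \sum_(s : {set 'I_N} | S \subset s) q p s = \det (principal K S).
Proof.
case: iidY => mesY _ lawY; apply: EFin_inj; rewrite -(lawY p).
by rewrite -(prob_finite_law P (mesY p) (fun s : {set 'I_N} => S \subset s)).
Qed.

Lemma det_principal_01 :
  (0 < n)%N -> forall S : {set 'I_N}, 0 <= \det (principal K S) <= 1.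
Proof.
move=> n_gt0 S; pose p := Ordinal n_gt0; case: (iidY) => mesY _ _.
rewrite -(sample_mean p) sumr_ge0 => [|s _]; last exact: (point_mass_ge0 P (mesY p)).
rewrite -(sum_point_mass P (mesY p)) [leRHS](bigID (fun s : {set 'I_N} => S \subset s)) /= lerDl.
by apply: sumr_ge0 => s _; exact: (point_mass_ge0 P (mesY p)).
Qed.

End Sample.

(** * Sample size and error guarantee *)

(** The accuracy required of the moments of the cycles. The square of its inverse
    is, up to a constant, the factor (4 / alpha)^(2 l) of the sample size: one factor alpha^l is the
    size of the cycle term, and 4^l compensates the number of matchings, at most
    2^l, and the number l < 2^l of factors in each. *)
Definition cycle_tolerance (R : realFieldType) (alpha : R) (l : nat) : R :=
  4^-1 * (alpha / 4) ^+ l.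

(** Capped by [cycle_tolerance], because the entries K_ii and B_hat i j also
    occur in the sums over matchings. *)
Definition pair_tolerance (R : realFieldType) (alpha eps : R) (l : nat) : R :=
  Num.min (alpha * eps / 3) (cycle_tolerance alpha l).

Lemma cycle_tolerance_gt0 (R : realFieldType) (alpha : R) l :
  0 < alpha -> 0 < cycle_tolerance alpha l.
Proof. by move=> ?; rewrite mulr_gt0 ?invr_gt0 ?exprn_gt0 ?divr_gt0. Qed.

Lemma cycle_tolerance_le (R : realFieldType) (alpha : R) l :
  0 < alpha < 1 -> (2 <= l)%N -> cycle_tolerance alpha l <= 64^-1 * alpha ^+ 2.
Proof.
case/andP=> alpha_gt0 alpha_lt1 l_ge2.
have : (alpha / 4) ^+ l <= (alpha / 4) ^+ 2.
  by rewrite ler_wiXn2l // ?divr_ge0 ?ltW //; lra.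
by rewrite /cycle_tolerance expr_div_n; lra.
Qed.

(** With h = 2^-l the left side is alpha^l (h^2 / 4 + l h), and l h <= 1. *)
Lemma cycle_tolerance_matchings (R : realFieldType) (alpha : R) (l : nat) :
    0 < alpha -> (2 <= l)%N ->
  (1 + 4 * l%:R * 2 ^+ l) * cycle_tolerance alpha l < 2 * alpha ^+ l.
Proof.
move=> alpha_gt0 l_ge2; rewrite /cycle_tolerance.
have a_gt0 : 0 < alpha ^+ l by rewrite exprn_gt0.
have h_gt0 : 0 < 2^-1 ^+ l :> R by rewrite exprn_gt0 // invr_gt0.
have h_le1 : 2^-1 ^+ l <= 1 :> R by rewrite exprn_ile1 // ?invr_ge0 // invf_le1 ?ler1n.
have lh : l%:R * 2^-1 ^+ l <= 1 :> R.
  by rewrite exprVn ler_pdivrMr ?exprn_gt0 // mul1r -natrX ler_nat ltnW // ltn_expl.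
have -> : (alpha / 4) ^+ l = alpha ^+ l * (2^-1 ^+ l * 2^-1 ^+ l).
  by rewrite exprMn -[X in _ = _ * X]exprMn; congr (_ * _ ^+ _); field.
have two : 2 ^+ l * 2^-1 ^+ l = 1 :> R by rewrite -exprMn divff ?expr1n // pnatr_eq0.
move: (2 ^+ l) (2^-1 ^+ l) (alpha ^+ l) (l%:R) two lh h_le1 h_gt0 a_gt0 => p h a L two lh h_le1 h_gt0 a_gt0.
have -> : (1 + 4 * L * p) * (4^-1 * (a * (h * h))) = a * (4^-1 * (h * h) + (L * h) * (p * h)) by field.
rewrite two mulr1 mulrC ltr_pM2r //.
have : h * h <= 1 by rewrite mulr_ile1 // ltW.
by lra.
Qed.

Section SampleSize.
Variables (R : realFieldType) (A alpha eps L : R) (n l : nat).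
Hypotheses (A_gt0 : 0 < A) (alpha_gt0 : 0 < alpha) (eps_gt0 : 0 < eps) (L_gt0 : 0 < L).
Hypothesis l_ge2 : (2 <= l)%N.
Hypothesis n_large :
  64 * (A + 4) * ((alpha ^+ 2 * eps ^+ 2)^-1 + l%:R * (4 / alpha) ^+ (2 * l)) * L <= n%:R.

Let X : R := (alpha ^+ 2 * eps ^+ 2)^-1.
Let Z : R := l%:R * (4 / alpha) ^+ (2 * l).

Let X_gt0 : 0 < X. Proof. by rewrite invr_gt0 mulr_gt0 ?exprn_gt0. Qed.

Let Z_gt0 : 0 < Z.
Proof. by rewrite mulr_gt0 ?exprn_gt0 ?divr_gt0 // ltr0n ltnW. Qed.

Let AL_gt0 : 0 < (A + 4) * L. Proof. by rewrite mulr_gt0 ?addr_gt0. Qed.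

Let n_large_split :
  64 * ((A + 4) * L) * X + 64 * ((A + 4) * L) * Z <= n%:R.
Proof.
by apply: le_trans n_large; rewrite le_eqVlt -subr_eq0 /X /Z; apply/orP; left; apply/eqP; ring.
Qed.

Let n_ge_X : 64 * ((A + 4) * L) * X <= n%:R.
Proof. by apply: le_trans n_large_split; rewrite lerDl ltW // mulr_gt0 // mulr_gt0. Qed.

Let n_ge_Z : 64 * ((A + 4) * L) * Z <= n%:R.
Proof. by apply: le_trans n_large_split; rewrite lerDr ltW // mulr_gt0 // mulr_gt0. Qed.

Lemma sample_size_gt0 : (0 < n)%N.
Proof. by rewrite -(ltr0n R); apply: lt_le_trans n_ge_X; rewrite mulr_gt0 // mulr_gt0. Qed.

Lemma sample_size_cycle :
  (l%:R + (A + 1) + 1) * L <= n%:R * cycle_tolerance alpha l ^+ 2 / 4.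
Proof.
have Z_tol : Z * cycle_tolerance alpha l ^+ 2 = 16^-1 * l%:R.
  rewrite /Z /cycle_tolerance [(4^-1 * _) ^+ 2]exprMn -exprM [(2 * l)%N]mulnC.
  have ab1 : (4 / alpha) ^+ (l * 2) * (alpha / 4) ^+ (l * 2) = 1.
    by rewrite -exprMn mulrA divfK ?gt_eqF // divff ?expr1n.
  rewrite [LHS](_ : _ = 16^-1 * l%:R * ((4 / alpha) ^+ (l * 2) * (alpha / 4) ^+ (l * 2))).
    by rewrite ab1 mulr1.
  by move: (_ ^+ (l * 2)) (_ ^+ (l * 2)) => a b; field.
have le_n : 64 * ((A + 4) * L) * (16^-1 * l%:R) <= n%:R * cycle_tolerance alpha l ^+ 2.
  by rewrite -Z_tol [leLHS]mulrA; exact: (ler_wpM2r (sqr_ge0 _) n_ge_Z).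
have lA : 0 <= (l%:R - 2) * A * L.
  by rewrite !mulr_ge0 ?subr_ge0 ?(ltW A_gt0) ?(ltW L_gt0) // ler_nat.
have lL : 0 <= (l%:R - 2) * L by rewrite mulr_ge0 ?subr_ge0 ?(ltW L_gt0) // ler_nat.
have AL : 0 < A * L by rewrite mulr_gt0.
rewrite ler_pdivlMr //; apply: le_trans le_n.
by have := L_gt0; lra.
Qed.

Lemma sample_size_pair :
  (2%:R + (A + 1) + 1) * L <= n%:R * pair_tolerance alpha eps l ^+ 2 / 4.
Proof.
rewrite /pair_tolerance; case: (leP (alpha * eps / 3)) => _; last first.
  apply: le_trans sample_size_cycle; rewrite ler_pM2r // !lerD2r.
  by rewrite ler_nat.
have X_tol : X * (alpha * eps / 3) ^+ 2 = 9^-1.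
  by rewrite /X; field; rewrite !gt_eqF.
have le_n : 64 * ((A + 4) * L) * 9^-1 <= n%:R * (alpha * eps / 3) ^+ 2.
  by rewrite -X_tol [leLHS]mulrA; exact: (ler_wpM2r (sqr_ge0 _) n_ge_X).
rewrite ler_pdivlMr //; apply: le_trans le_n.
have AL : 0 < A * L by rewrite mulr_gt0.
by have := L_gt0; lra.
Qed.

End SampleSize.

Section Guarantee.
Context (R : realType) (d : measure_display) (T : measurableType d).
Variables (P : probability T R) (N n l : nat) (alpha eps : R) (K : 'M[R]_N) (s0 : int).
Variables (Y : 'I_n -> T -> {set 'I_N}) (est : {ffun 'I_n -> {set 'I_N}} -> 'M[R]_N).
Hypothesis alpha01 : 0 < alpha < 1.
Hypothesis eps_gt0 : 0 < eps.
Hypothesis symK : K^T = K.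
Hypothesis gapK : forall i j : 'I_N, (i < j)%N -> K i j = 0 \/ alpha <= `|K i j|.
Hypothesis sparsK : is_cycle_sparsity (graph_of K) l.
Hypothesis iidY : iid_DPP P K Y.
Hypothesis n_gt0 : (0 < n)%N.
Hypothesis estY : forall y, moment_estimate alpha s0 y (est y).

Let tau := cycle_tolerance alpha l.
Let delta := pair_tolerance alpha eps l.

Let alpha_gt0 : 0 < alpha. Proof. by case/andP: alpha01. Qed.
Let tau_gt0 : 0 < tau. Proof. exact: cycle_tolerance_gt0. Qed.
Let delta_gt0 : 0 < delta.
Proof. by rewrite lt_min tau_gt0 divr_gt0 ?mulr_gt0. Qed.
Let delta_tau : delta <= tau. Proof. by rewrite ge_min lexx orbT. Qed.
Let delta_eps : 3 * delta <= alpha * eps.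
Proof. by rewrite mulrC -ler_pdivlMr // ge_min lexx. Qed.
Let tau_le : tau <= 64^-1 * alpha ^+ 2.
Proof. by apply: cycle_tolerance_le alpha01 _; exact: cycle_sparsity_ge2 sparsK. Qed.
Let alpha2_gt0 : 0 < alpha ^+ 2. Proof. by rewrite exprn_gt0. Qed.
Let alpha2_lt1 : alpha ^+ 2 < 1.
Proof. by case/andP: alpha01 => _ lt1; rewrite exprn_ilt1 // ltW. Qed.

Definition deviates (k : nat) (e : R) (w : {ffun 'I_n -> {set 'I_N}}) : bool :=
  [exists S : {set 'I_N}, ((S != finset.set0) && (#|S| <= k)%N)
     && (e < `|Delta_hat R w S - \det (principal K S)|)].

Lemma not_deviates k e w : ~~ deviates k e w ->
  forall S : {set 'I_N}, S != finset.set0 -> (#|S| <= k)%N ->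
  `|Delta_hat R w S - \det (principal K S)| <= e.
Proof.
by move=> /existsPn Ndev S S0 Sk; have := Ndev S; rewrite S0 Sk /= -leNgt.
Qed.

Lemma rho_le_of_moments w :
  ~~ deviates 2 delta w -> ~~ deviates l tau w -> rho (est w) K <= eps.
Proof.
move=> Ndev2 Ndevl.
have three_delta : 3 * delta < 2^-1 * alpha ^+ 2.
  by have := delta_tau; have := tau_le; have := alpha2_gt0; lra.
have delta_le : delta <= eps.
  have alpha_eps : alpha * eps <= eps by rewrite ler_piMl ?ltW //; case/andP: alpha01.
  by have := delta_eps; have := delta_gt0; lra.
have [D [signD closeD]] : exists D : 'M[R]_N, sign_diag D /\
    forall i j, `|(D *m est w *m D - K) i j| <= eps.
  apply: (@estimate_recovers R N n l alpha delta tau K w alpha01 symK gapK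
    (det_principal_01 iidY n_gt0) (ltW delta_gt0) (not_deviates Ndev2) three_delta
    (not_deviates Ndevl) delta_tau _ sparsK s0 eps (est w)) => //.
  by apply: cycle_tolerance_matchings => //; exact: cycle_sparsity_ge2 sparsK.
exact: rho_le (ltW eps_gt0) signD closeD.
Qed.

Variables (A : R).
Hypothesis N_gt1 : (1 < N)%N.
Hypothesis n_pair : (2%:R + (A + 1) + 1) * ln N%:R <= n%:R * delta ^+ 2 / 4.
Hypothesis n_cycle : (l%:R + (A + 1) + 1) * ln N%:R <= n%:R * tau ^+ 2 / 4.

Let q p s := point_mass P (Y p) s.

(** A sample with rho > eps has an inaccurate moment, either of a set of size at
    most two or of a set of size at most l. Each of these events has probability
    at most N^(-A-1), and 2 N^(-A-1) <= N^(-A) as N is at least two. *)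
Lemma prob_rho_le :
  ((1 - N%:R `^ (- A))%:E <= P [set t | (rho (est [ffun p => Y p t]) K <= eps)%R])%E.
Proof.
have [mesY _ _] := iidY.
have q_ge0 p s : 0 <= q p s by exact: (point_mass_ge0 P (mesY p)).
have q_sum1 p : \sum_s q p s = 1 by exact: (sum_point_mass P (mesY p)).
have q_mean p (S : {set 'I_N}) : \sum_(s : {set 'I_N} | S \subset s) q p s = \det (principal K S).
  exact: sample_mean.
have tail k e : 0 <= e <= 2^-1 -> (k%:R + (A + 1) + 1) * ln N%:R <= n%:R * e ^+ 2 / 4 ->
    \sum_(w | deviates k e w) product_mass q w <= expR (- ((A + 1) * ln N%:R)).
  move=> e01 le_e; apply: le_trans (union_tail_le N_gt1 le_e).
  exact: (uniform_deviation q_ge0 q_sum1 q_mean (det_principal_01 iidY n_gt0) n_gt0).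
have tau_half : tau <= 2^-1 by have := tau_le; have := alpha2_lt1; lra.
have tail2 := tail 2%N delta; rewrite ltW //= (le_trans delta_tau tau_half) in tail2.
have taill := tail l tau; rewrite ltW //= tau_half in taill.
pose good w := rho (est w) K <= eps.
rewrite (prob_finite_law P (sample_measurable iidY) good) lee_fin.
rewrite (eq_bigr (product_mass q)) => [|w _]; last exact: (sample_point_mass iidY w).
rewrite lerBlDr -[leLHS](sum_product_mass q_sum1) (bigID good) /= lerD2l.
apply: le_trans (_ : \sum_(w | deviates 2 delta w) product_mass q w
    + \sum_(w | deviates l tau w) product_mass q w <= _).
  rewrite [leLHS]big_mkcond [X in _ <= X + _]big_mkcond [X in _ <= _ + X]big_mkcond -big_split /=.
  apply: ler_sum => w _; have m_ge0 := product_mass_ge0 q_ge0 w.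
  have [_|Ngood] /= := boolP (good w); first by rewrite addr_ge0 //; case: ifP.
  have [_|Ndev2] := boolP (deviates 2 delta w); first by rewrite lerDl; case: ifP.
  have [_|Ndevl] := boolP (deviates l tau w); first by rewrite add0r.
  by rewrite /good rho_le_of_moments in Ngood.
apply: le_trans (lerD (tail2 isT n_pair) (taill isT n_cycle)) _.
have N_gt0 : 0 < N%:R :> R by rewrite ltr0n ltnW.
have -> : N%:R `^ (- A) = expR (- (A * ln N%:R)) by rewrite /powR gt_eqF // mulNr.
have two_le : 2 <= expR (ln N%:R) :> R by rewrite lnK ?posrE // ler_nat.
rewrite -mulr2n -[leLHS]mulr_natl.
apply: le_trans (_ : expR (ln N%:R) * expR (- ((A + 1) * ln N%:R)) <= _).
  by rewrite ler_wpM2r ?expR_ge0.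
by rewrite -expRD ler_expR mulrDl mul1r opprD addrCA subrr addr0.
Qed.

End Guarantee.

Theorem theorem1 (R : realType) (A : R) (hA : 0 < A) :
  exists C : R, 0 < C /\
    forall (alpha eps : R) (N n l : nat) (K : 'M[R]_N) (s0 : int)
      (d : measure_display) (T : measurableType d) (P : probability T R)
      (Y : 'I_n -> T -> {set 'I_N})
      (est : {ffun 'I_n -> {set 'I_N}} -> 'M[R]_N),
    (0 < N)%N ->
    0 < alpha < 1 ->
    K^T = K -> psd K -> psd (1%:M - K) ->
    (forall i j : 'I_N, (i < j)%N -> K i j = 0 \/ alpha <= `|K i j|) ->
    is_cycle_sparsity (graph_of K) l ->
    0 < eps ->
    iid_DPP P K Y ->
    s0 = -1 \/ s0 = 1 ->
    (forall y, moment_estimate alpha s0 y (est y)) ->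
    C * ((alpha ^+ 2 * eps ^+ 2)^-1 + l%:R * (4 / alpha) ^+ (2 * l))
      * ln N%:R <= n%:R ->
    ((1 - N%:R `^ (- A))%:E
       <= P [set t | (rho (est [ffun p => Y p t]) K <= eps)%R])%E.
Proof.
(* The two sizes asked for by [prob_rho_le] are (A + 4) ln N and
   (l + A + 2) ln N, the latter at most l (A + 4) ln N; the tolerances contribute
   the constants 4 * 9 and 4 * 16, of which 64 is the larger. *)
exists (64 * (A + 4)); split; first by rewrite mulr_gt0 ?addr_gt0.
move=> alpha eps N n l K s0 d T P Y est N_gt0 alpha01 symK _ _ gapK sparsK eps_gt0.
move=> iidY _ estY n_large.
(* For N = 1 the probability bound is 1 - 1 = 0, while ln N = 0 imposes
   no condition on n. *)
have [N_le1|N_gt1] := leqP N 1.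
  have -> : N%:R = 1 :> R by rewrite (_ : N = 1%N) //; apply/eqP; rewrite eqn_leq N_le1.
  by rewrite powR1 subrr.
have l_ge2 := cycle_sparsity_ge2 sparsK; have /andP[alpha_gt0 _] := alpha01.
have L_gt0 : 0 < ln N%:R :> R by rewrite ln_gt0 // ltr1n.
apply: (prob_rho_le alpha01 eps_gt0 symK gapK sparsK iidY _ estY N_gt1).
- exact: (sample_size_gt0 hA alpha_gt0 eps_gt0 L_gt0 l_ge2 n_large).
- exact: (sample_size_pair hA alpha_gt0 eps_gt0 L_gt0 l_ge2 n_large).
- exact: (sample_size_cycle hA alpha_gt0 eps_gt0 L_gt0 l_ge2 n_large).
Qed.
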